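(* Let $\Omega\subseteq\mathcal A^d$ be a balanced NC domain and let $F:\Omega\to B(\mathcal H)$ be a function. The following are equivalent. (i) The function $F$ is NC. (ii) There is a power series expansion $\sum_{k=0}^\infty p_k(x)$ that converges absolutely and locally uniformly at each point $x\in\Omega$ to $F(x)$, and such that each $p_k$ is a homogeneous free polynomial of degree $k$. (iii) For any triple of points in $\Omega$, there is a sequence of free polynomials that converge uniformly to $F$ on a neighborhood of each point in the triple.
   Context: Throughout, $\mathcal H$ is an infinite-dimensional complex Hilbert space, $\mathcal H^{(n)}=\oplus_{j=1}^n\mathcal H$, and $\mathcal A\subseteq B(\mathcal H)$ is a unital norm-closed subalgebra with the direct sum property: for every $n\ge1$ there is a unitary $U_n:\mathcal H^{(n)}\to\mathcal H$ with $U_n\,\mathcal T_n(\mathcal A)\,U_n^*\subseteq\mathcal A$, where $\mathcal T_n(\mathcal A)$ is the set of upper triangular $n\times n$ matrices with entries in $\mathcal A$. Fix a positive integer $d$; $d$-tuples are written $x=(x^1,\dots,x^d)$, $\mathcal A^d$ carries the relative norm topology, and products, direct sums, conjugations etc. of $d$-tuples with operators are taken coordinatewise. NC domain: a set $\Omega\subseteq\mathcal A^d$ that is open, bounded, and closed under finite direct sums: for each $n\ge2$, with the unitary $U_n:\mathcal H^{(n)}\to\mathcal H$ (the same one as in the direct sum property of $\mathcal A$), $U_n(x_1\oplus\cdots\oplus x_n)U_n^*\in\Omega$ whenever $x_1,\dots,x_n\in\Omega$. NC function: $F:\Omega\to B(\mathcal H)$ that is locally bounded on $\Omega$ and intertwining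 preserving, i.e. whenever $x,y\in\Omega$ and $L\in B(\mathcal H)$ satisfy $Lx^r=y^rL$ for $1\le r\le d$, then $LF(x)=F(y)L$. $\Omega$ is balanced if $\alpha\Omega\subseteq\Omega$ for every $\alpha\in\mathbb C$ with $|\alpha|\le1$. A free polynomial is a polynomial with complex coefficients in the $d$ non-commuting variables $x^1,\dots,x^d$ (constants, evaluated as multiples of the identity, allowed). Convergence is in operator norm. *)

(* Defs.v *)
From HB Require Import structures.
From mathcomp Require Import all_boot all_order all_algebra.
From mathcomp Require Import sesquilinear complex finmap.
From mathcomp Require Import all_classical all_reals topology normedtype.
From mathcomp Require Import sequences.
(* The notations of [monalg] clash with those of the analysis library. *)
From mathcomp Require Import -(notations) monalg.

Set Implicit Arguments.
Unset Strict Implicit.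
Unset Printing Implicit Defensive.

Import Order.TTheory GRing.Theory Num.Theory.
Import numFieldNormedType.Exports.

Local Open Scope classical_set_scope.
Local Open Scope complex_scope.
Local Open Scope ring_scope.

(* [dot] is linear in its first argument and conjugate-linear in the second. *)
HB.mixin Record CompleteNormedModule_isHilbert (R : realType) (H : Type)
    of CompleteNormedModule R[i] H := {
  dot : {dot H for Num.conj};
  dotxx : forall x : H, dot x x = `|x| ^+ 2
}.

#[short(type="hilbertType")]
HB.structure Definition Hilbert (R : realType) :=
  {H of CompleteNormedModule R[i] H & CompleteNormedModule_isHilbert R H}.

Definition infinite_dimensional (R : realType) (H : hilbertType R) : Prop :=
  forall (n : nat) (e : 'I_n -> H),
    exists x : H, forall a : 'I_n -> R[i], x <> \sum_i a i *: e i.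

Record bop (R : realType) (H : hilbertType R) : Type := Bop {
  bop_fun :> H -> H;
  bop_linear : linear bop_fun;
  bop_continuous : continuous bop_fun
}.
Arguments bop {R} H.

HB.instance Definition _ (R : realType) (H : hilbertType R) (T : bop H) :=
  GRing.isLinear.Build R[i] H H *:%R T (bop_linear T).

HB.instance Definition _ (R : realType) (H : hilbertType R) :=
  gen_eqMixin (bop H).
HB.instance Definition _ (R : realType) (H : hilbertType R) :=
  gen_choiceMixin (bop H).

Section OperatorAlgebra.
Context {R : realType} {H : hilbertType R}.
Implicit Types S T : bop H.

Lemma bopP S T : (forall x, S x = T x) -> S = T.
Proof.
case: S T => [f lf cf] [g lg cg] /= /funext fg.
by rewrite fg in lf cf *; congr Bop; apply: Prop_irrelevance.
Qed.

Fact zero_bop_linear : linear (fun _ : H => 0 : H).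
Proof. by move=> a x y; rewrite scaler0 addr0. Qed.
Definition zero_bop : bop H :=
  Bop zero_bop_linear (fun x => cvg_cst (0 : H)).

Fact opp_bop_linear T : linear (fun x => - T x).
Proof. by move=> a x y; rewrite linearP opprD scalerN. Qed.
Fact opp_bop_continuous T : continuous (fun x => - T x).
Proof. by move=> x; apply: cvgN; exact: bop_continuous. Qed.
Definition opp_bop T : bop H :=
  Bop (opp_bop_linear T) (opp_bop_continuous (T := T)).

Fact add_bop_linear S T : linear (fun x => S x + T x).
Proof. by move=> a x y; rewrite !linearP scalerDr addrACA. Qed.
Fact add_bop_continuous S T : continuous (fun x => S x + T x).
Proof. by move=> x; apply: cvgD; exact: bop_continuous. Qed.
Definition add_bop S T : bop H :=
  Bop (add_bop_linear S T) (add_bop_continuous (S := S) (T := T)).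

Fact scale_bop_linear (a : R[i]) T : linear (fun x => a *: T x).
Proof. by move=> b x y; rewrite linearP scalerDr !scalerA mulrC. Qed.
Fact scale_bop_continuous (a : R[i]) T : continuous (fun x => a *: T x).
Proof. by move=> x; apply: cvgZr; exact: bop_continuous. Qed.
Definition scale_bop (a : R[i]) T : bop H :=
  Bop (scale_bop_linear a T) (scale_bop_continuous (a := a) (T := T)).

Fact one_bop_linear : linear (fun x : H => x).
Proof. by []. Qed.
Definition one_bop : bop H :=
  Bop one_bop_linear (fun x => cvg_id).

Fact comp_bop_linear S T : linear (fun x => S (T x)).
Proof. by move=> a x y; rewrite !linearP. Qed.
Fact comp_bop_continuous S T : continuous (fun x => S (T x)).
Proof.
move=> x; apply: (@continuous_comp _ _ _ T S); exact: bop_continuous.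
Qed.
Definition comp_bop S T : bop H :=
  Bop (comp_bop_linear S T) (comp_bop_continuous (S := S) (T := T)).

Fact add_bopA : associative add_bop.
Proof. by move=> S T V; apply: bopP => x /=; rewrite addrA. Qed.
Fact add_bopC : commutative add_bop.
Proof. by move=> S T; apply: bopP => x /=; rewrite addrC. Qed.
Fact add_bop0 : left_id zero_bop add_bop.
Proof. by move=> T; apply: bopP => x /=; rewrite add0r. Qed.
Fact add_bopN : left_inverse zero_bop opp_bop add_bop.
Proof. by move=> T; apply: bopP => x /=; rewrite addNr. Qed.

HB.instance Definition _ :=
  GRing.isZmodule.Build (bop H) add_bopA add_bopC add_bop0 add_bopN.

Fact comp_bopA : associative comp_bop.
Proof. by move=> S T V; apply: bopP. Qed.
Fact comp_bop1l : left_id one_bop comp_bop.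
Proof. by move=> T; apply: bopP. Qed.
Fact comp_bop1r : right_id one_bop comp_bop.
Proof. by move=> T; apply: bopP. Qed.
Fact comp_bopDl : left_distributive comp_bop +%R.
Proof. by move=> S T V; apply: bopP. Qed.
Fact comp_bopDr : right_distributive comp_bop +%R.
Proof. by move=> S T V; apply: bopP => x /=; rewrite linearD. Qed.

HB.instance Definition _ :=
  GRing.Zmodule_isPzRing.Build (bop H)
    comp_bopA comp_bop1l comp_bop1r comp_bopDl comp_bopDr.

Fact scale_bopA a b T : scale_bop a (scale_bop b T) = scale_bop (a * b) T.
Proof. by apply: bopP => x /=; rewrite scalerA. Qed.
Fact scale_bop1 : left_id 1 scale_bop.
Proof. by move=> T; apply: bopP => x /=; rewrite scale1r. Qed.
Fact scale_bopDr : right_distributive scale_bop +%R.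
Proof. by move=> a S T; apply: bopP => x /=; rewrite scalerDr. Qed.
Fact scale_bopDl T : {morph scale_bop^~ T : a b / a + b}.
Proof. by move=> a b; apply: bopP => x /=; rewrite scalerDl. Qed.

HB.instance Definition _ :=
  GRing.Zmodule_isLmodule.Build R[i] (bop H)
    scale_bopA scale_bop1 scale_bopDr scale_bopDl.

Lemma addbE S T x : (S + T) x = S x + T x. Proof. by []. Qed.
Lemma oppbE T x : (- T) x = - T x. Proof. by []. Qed.
Lemma scalebE (a : R[i]) T x : (a *: T) x = a *: T x. Proof. by []. Qed.
Lemma mulbE S T x : (S * T) x = S (T x). Proof. by []. Qed.

End OperatorAlgebra.

Section OperatorNorm.
Context {R : realType} {H : hilbertType R}.
Implicit Types S T : bop H.

Definition opnorm T : R :=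
  sup [set complex.Re `|T x| | x in [set x : H | `|x| <= 1]].

Lemma Re_normK (x : H) : (complex.Re `|x|)%:C = `|x|.
Proof. by apply: RRe_real; rewrite ger0_real. Qed.

Lemma bop_bounded T : exists2 M : R, 0 <= M & forall x, `|T x| <= M%:C * `|x|.
Proof.
have /linear_bounded_continuous/linear_boundedP : continuous T
  by exact: bop_continuous.
rewrite /= => /pinfty_ex_gt0[M M0 TM]; exists (complex.Re M); last first.
  by move=> x; rewrite RRe_real ?gtr0_real.
by rewrite -lecR RRe_real ?gtr0_real// ltW.
Qed.

Lemma opnorm_set_has_sup T :
  has_sup [set complex.Re `|T x| | x in [set x : H | `|x| <= 1]].
Proof.
split; first by exists (complex.Re `|T 0|); exists 0; rewrite //= normr0.
have [M M0 TM] := bop_bounded T; exists M => _ [x /= x1 <-].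
rewrite -lecR Re_normK (le_trans (TM x))// ler_piMr//.
by rewrite lecR.
Qed.

Lemma opnorm_ge0 T : 0 <= opnorm T.
Proof.
apply: sup_upper_bound (opnorm_set_has_sup T) _ _.
by exists 0; rewrite /= ?linear0 normr0.
Qed.

Lemma opnormP T x : `|T x| <= (opnorm T)%:C * `|x|.
Proof.
have [->|x0] := eqVneq x 0; first by rewrite linear0 !normr0 mulr0.
have nx0 : 0 < `|x| by rewrite normr_gt0.
have : `|T (`|x|^-1 *: x)| <= (opnorm T)%:C.
  rewrite -Re_normK lecR; apply: sup_upper_bound (opnorm_set_has_sup T) _ _.
  exists (`|x|^-1 *: x) => //=.
  by rewrite normrZ ger0_norm ?invr_ge0// mulVf ?gt_eqF.
by rewrite linearZ normrZ ger0_norm ?invr_ge0// ler_pdivrMl// mulrC.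
Qed.

Lemma opnorm_le T (M : R) : 0 <= M ->
  (forall x, `|T x| <= M%:C * `|x|) -> opnorm T <= M.
Proof.
move=> M0 TM; apply: ge_sup; first by case: (opnorm_set_has_sup T).
move=> _ [x /= x1 <-]; rewrite -lecR Re_normK (le_trans (TM x))//.
by rewrite ler_piMr// lecR.
Qed.

Fact opnormD S T : (opnorm (S + T))%:C <= (opnorm S)%:C + (opnorm T)%:C.
Proof.
rewrite -rmorphD lecR; apply: opnorm_le => [|x].
  by rewrite addr_ge0 ?opnorm_ge0.
rewrite rmorphD mulrDl addbE (le_trans (ler_normD _ _))//.
by rewrite lerD ?opnormP.
Qed.

Fact opnormZ (a : R[i]) T : (opnorm (a *: T))%:C = `|a| * (opnorm T)%:C.
Proof.
have opnormZ_le (b : R[i]) V :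
    (opnorm (b *: V))%:C <= `|b| * (opnorm V)%:C.
  have bE : (complex.Re `|b|)%:C = `|b| by rewrite RRe_real ?ger0_real.
  rewrite -bE -rmorphM lecR; apply: opnorm_le => [|x].
    by rewrite mulr_ge0 ?opnorm_ge0// -lecR bE normr_ge0.
  by rewrite rmorphM /= bE normrZ -mulrA ler_wpM2l// opnormP.
apply/eqP; rewrite eq_le opnormZ_le /=.
have [->|a0] := eqVneq a 0; first by rewrite normr0 mul0r lecR opnorm_ge0.
rewrite -ler_pdivlMl ?normr_gt0// -normfV.
by rewrite (le_trans _ (opnormZ_le _ _))// scalerA mulVf// scale1r.
Qed.

Fact opnorm_eq0 T : (opnorm T)%:C = 0 -> T = 0.
Proof.
move=> T0; apply: bopP => x; apply/eqP; rewrite -normr_le0.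
by rewrite (le_trans (opnormP T x))// T0 mul0r.
Qed.

HB.instance Definition _ :=
  Lmodule_isNormed.Build R[i] (bop H) opnormD opnormZ opnorm_eq0.

End OperatorNorm.

Section Unitary.
Context {R : realType} {H : hilbertType R}.

(* The function space ['I_n -> H] stands for H^(n), with the inner product
   \sum_j dot (u j) (v j), and [uadj] is the adjoint of [ufun]. *)
Record unitary (n : nat) : Type := Unitary {
  ufun :> ('I_n -> H) -> H;
  uadj : H -> 'I_n -> H;
  ufun_linear : linear ufun;
  uadjP : forall (u : 'I_n -> H) (h : H),
    dot (ufun u) h = \sum_j dot (u j) (uadj h j);
  uadjK : cancel uadj ufun;
  ufunK : cancel ufun uadj
}.

Context {n : nat}.
Implicit Types (U : unitary n) (T : 'M[bop H]_n).

Lemma uadj_linear U : linear (uadj U).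
Proof.
move=> a x y; apply: (can_inj (ufunK U)).
by rewrite ufun_linear !uadjK.
Qed.

Lemma unitary_norm U u : `|U u| ^+ 2 = \sum_j `|u j| ^+ 2.
Proof.
by rewrite -dotxx uadjP; apply: eq_bigr => j _; rewrite ufunK dotxx.
Qed.

Lemma unitary_norm_le U u : `|U u| <= \sum_j `|u j|.
Proof.
rewrite -(@ler_pXn2r _ 2)// ?nnegrE ?sumr_ge0// unitary_norm.
suff: 0 <= \sum_j `|u j| /\ \sum_j `|u j| ^+ 2 <= (\sum_j `|u j|) ^+ 2.
  by case.
elim/big_rec2: _ => [|j y1 y2 _ [y1_ge0 y21]]; first by rewrite expr0n.
split; first by rewrite addr_ge0.
rewrite sqrrD -addrA lerD2l (le_trans y21)// lerDr.
by rewrite mulrn_wge0// mulr_ge0.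
Qed.

Lemma uadj_norm_le U h j : `|uadj U h j| <= `|h|.
Proof.
rewrite -(@ler_pXn2r _ 2)// ?nnegrE// -[in leRHS](uadjK U h) unitary_norm.
by rewrite (bigD1 j)//= lerDl sumr_ge0// => i _; rewrite exprn_ge0.
Qed.

Fact opconj_linear U T :
  linear (fun h => U (fun i => \sum_j T i j (uadj U h j))).
Proof.
move=> a x y; rewrite -ufun_linear; congr (ufun U _); apply/funext => i.
rewrite -[RHS]/(a *: (\sum_j T i j (uadj U x j)) + \sum_j T i j (uadj U y j)).
rewrite scaler_sumr -big_split /=; apply: eq_bigr => j _.
by rewrite -linearP uadj_linear.
Qed.

Fact opconj_continuous U T :
  continuous (fun h => U (fun i => \sum_j T i j (uadj U h j))).
Proof.
pose f h := U (fun i => \sum_j T i j (uadj U h j)).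
pose fL := GRing.isLinear.Build R[i] H H *:%R f (opconj_linear U T).
pose g : {linear H -> H} := HB.pack f fL.
apply: (@bounded_linear_continuous _ _ _ g); apply/linear_boundedP.
pose M : R := \sum_i \sum_j opnorm (T i j).
exists M%:C; split; first by rewrite realE lecR /M; apply/orP; left;
  do 2?[apply: sumr_ge0 => ? _]; exact: opnorm_ge0.
move=> r /ltW Mr h /=; apply: (@le_trans _ _ (M%:C * `|h|)); last first.
  by rewrite ler_wpM2r.
rewrite (le_trans (unitary_norm_le _ _))// rmorph_sum mulr_suml.
apply: ler_sum => i _; rewrite (le_trans (ler_norm_sum _ _ _))//.
rewrite rmorph_sum mulr_suml; apply: ler_sum => j _.
rewrite (le_trans (opnormP _ _))// ler_wpM2l ?uadj_norm_le//.
by rewrite lecR opnorm_ge0.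
Qed.

(* U T U^*, for T an operator on H^(n) given as a matrix of operators on H. *)
Definition opconj U T : bop H :=
  Bop (opconj_linear U T) (opconj_continuous (U := U) (T := T)).

End Unitary.
Arguments unitary {R} H n.

Section NCFunctions.
Context {R : realType} {H : hilbertType R}.
Implicit Types A : set (bop H).

Definition unital_subalgebra A : Prop :=
  [/\ A 1,
      forall S T, A S -> A T -> A (S + T),
      forall (a : R[i]) T, A T -> A (a *: T) &
      forall S T, A S -> A T -> A (S * T)].

(* H^(0) is the zero space, so the unitaries are indexed by n.+1. *)
Definition direct_sum_property A (U : forall n, unitary H n.+1) : Prop :=
  forall n (T : 'M[bop H]_n.+1),
    (forall i j, A (T i j)) ->
    (forall i j : 'I_n.+1, (j < i)%N -> T i j = 0) ->
    A (opconj (U n) T).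

Context {d : nat}.

Definition tuples_in A : set 'rV[bop H]_d := [set x | forall r, A (x 0 r)].

Definition conj_dsum n (U : unitary H n) (x : 'I_n -> 'rV[bop H]_d) :
    'rV[bop H]_d :=
  \row_r opconj U (diag_mx (\row_j x j 0 r)).

Record nc_domain A (U : forall n, unitary H n.+1) (Omega : set 'rV[bop H]_d)
    : Prop := NCDomain {
  nc_domain_sub : Omega `<=` tuples_in A;
  nc_domain_open :
    exists2 O : set 'rV[bop H]_d, open O & Omega = O `&` tuples_in A;
  nc_domain_bounded : forall r, [bounded x 0 r | x in Omega];
  nc_domain_dsum : forall n (x : 'I_n.+2 -> 'rV[bop H]_d),
    (forall j, Omega (x j)) -> Omega (conj_dsum (U n.+1) x)
}.

Definition balanced (Omega : set 'rV[bop H]_d) : Prop :=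
  forall (a : R[i]) x, `|a| <= 1 -> Omega x ->
    Omega (\row_r (a *: x 0 r)).

(* Only the values of [F] on [Omega] matter, here and below. *)
Definition intertwining_preserving (Omega : set 'rV[bop H]_d)
    (F : 'rV[bop H]_d -> bop H) : Prop :=
  forall x y (L : bop H), Omega x -> Omega y ->
    (forall r, L * x 0 r = y 0 r * L) -> L * F x = F y * L.

Definition nc_function (Omega : set 'rV[bop H]_d)
    (F : 'rV[bop H]_d -> bop H) : Prop :=
  [locally [bounded F x | x in Omega]] /\ intertwining_preserving Omega F.

Definition uniform_cvg_near (Omega : set 'rV[bop H]_d)
    (f : nat -> 'rV[bop H]_d -> bop H) (F : 'rV[bop H]_d -> bop H)
    (x : 'rV[bop H]_d) : Prop :=
  exists2 W, nbhs x W & {uniform Omega `&` W, f @ \oo --> F}.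

End NCFunctions.

(* The algebra C<x^1, ..., x^d>, as the monoid algebra of the free monoid. *)
Notation free_poly R d := (malg (fmonom 'I_d) (complex R)).

Definition peval (R : realType) (H : hilbertType R) (d : nat)
    (p : free_poly R d) (x : 'rV[bop H]_d) : bop H :=
  \sum_(w <- msupp p) mcoeff w p *: \prod_(i <- (w : seq 'I_d)) x 0 i.

(* The zero polynomial is homogeneous of every degree. *)
Definition homogeneous_poly (R : realType) (d k : nat) (p : free_poly R d) :=
  forall w : fmonom 'I_d, w \in msupp p -> fdeg w = k.

(* Main.v *)
Require Import Defs.
From HB Require Import structures.
From mathcomp Require Import all_boot all_order all_algebra ring lra zify.
From mathcomp Require Import complex finmap.
From mathcomp Require Import all_classical all_reals topology normedtype.
From mathcomp Require Import sequences trigo.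
From mathcomp Require Import -(notations) monalg.

                                                                             
                                                                          
                                                                              
                                                                             
                                                            
                                                                        
                                                                        
                                                                       
                                                                           
                                                                            
                                                                              
                                                  

Set Implicit Arguments.
Unset Strict Implicit.
Unset Printing Implicit Defensive.

Import Order.TTheory GRing.Theory Num.Theory.
Import numFieldNormedType.Exports.

Local Open Scope classical_set_scope.
Local Open Scope ring_scope.

(** The heart of the matter is that an NC function is the sum of a power series of free polynomials.
    Partial sums of the series then approximate it near any given points. Conversely, free
    polynomials preserve intertwinings and are bounded on the bounded set [Omega], and both facts
    survive local uniform limits.

    The Taylor polynomials are read off at a universal nilpotent point. Left creation operators,
    truncated to the words of length at most [m] and scaled by a small [t], form the tuple
    [creation t]. It is upper triangular when long words come first, and it lies in [Omega] because
    balance puts 0 there. Since [F (creation t)] commutes with the diagonal copies of every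
    operator, its blocks are scalar ([creation_compression]); the column of the empty word holds the
    coefficients, up to powers of [t]. An explicit intertwiner carries them to a block in the first
    row of [F (tensor V T x)], for each [T] whose columns up to [m] are those of [e] times the shift
    ([tensor_creation]). Hence one polynomial serves all points [x] ([homogeneous_part]).

    For the remainder, let [T] be bidiagonal with diagonal 0 ([k] times), 1, [a], [b], [c].
    Eigenvectors of [T] intertwine [l x] with [tensor V T x], so the first row of the value of [F]
    there gives, after division by powers of [e], the Newton divided differences of [l |-> F (l x)].
    The first [k] are the terms [p m] at [x], the next is the remainder of the series, and the last
    three are bounded uniformly in [a], [b], [c] by compactness ([jordan_domain]). These bounds
    stand in for holomorphy on a disc of radius [rad > 1]: averaging over equally spaced points of
    the circle yields Cauchy's estimate ([circle_mean_le], [cauchy_remainder]), hence a remainder of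
    order [rad ^- k]. As [rad] and the bound on [F] hold for all points near [x] ([dilated_disc]),
    convergence is locally uniform. *)

Local Notation normc := ComplexField.Normc.normc.
Local Notation "x %:C" := (real_complex _ x).

                                              

(** * Complex moduli and operator norms *)

Section Modulus.
Context {R : realType}.
Implicit Types z w : R[i].

Lemma normcE z : (normc z)%:C = `|z|. Proof. by []. Qed.

Lemma normc_ge0 z : 0 <= normc z.
Proof. by case: z => a b; rewrite sqrtr_ge0. Qed.

Lemma normc_le z (r : R) : (normc z <= r) = (`|z| <= r%:C).
Proof. by rewrite -normcE lecR. Qed.

Lemma normcD_le z w : normc (z + w) <= normc z + normc w.
Proof. by rewrite -lecR rmorphD /= !normcE ler_normD. Qed.

Lemma normcMr z w : normc (z * w) = normc z * normc w.
Proof. exact: ComplexField.Normc.normcM. Qed.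

Lemma normc_eq0 z : (normc z == 0) = (z == 0).
Proof.
apply/eqP/eqP => [|->]; first exact: ComplexField.Normc.eq0_normc.
by rewrite /= expr0n addr0 sqrtr0.
Qed.

Lemma normcVr z : normc z^-1 = (normc z)^-1.
Proof. exact: ComplexField.Normc.normcV. Qed.

Lemma normcNr z : normc (- z) = normc z.
Proof. by have /(congr1 (@complex.Re R)) := normrN z. Qed.

Lemma normcX z n : normc (z ^+ n) = normc z ^+ n.
Proof.
elim: n => [|n ih]; first by rewrite !expr0 ComplexField.Normc.normc1.
by rewrite !exprS normcMr ih.
Qed.

Lemma normc_real (r : R) : normc r%:C = `|r|.
Proof. by rewrite /= expr0n addr0 sqrtr_sqr. Qed.
End Modulus.

Section OperatorCalculus.
Context {R : realType} {H : hilbertType R}.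
Implicit Types S T : bop H.

Lemma mulbZl (a : R[i]) S T : (a *: S) * T = a *: (S * T).
Proof. exact: bopP. Qed.

Lemma mulbZr (a : R[i]) S T : S * (a *: T) = a *: (S * T).
Proof. by apply: bopP => x; rewrite scalebE !mulbE scalebE linearZ. Qed.

Lemma opnorm_normE T : `|T| = (opnorm T)%:C. Proof. by []. Qed.

Lemma opnorm_normle T (r : R) : (opnorm T <= r) = (`|T| <= r%:C).
Proof. by rewrite opnorm_normE lecR. Qed.

Lemma opnormD_le S T : opnorm (S + T) <= opnorm S + opnorm T.
Proof. by rewrite -lecR rmorphD /= opnormD. Qed.

Lemma opnorm0 : opnorm (0 : bop H) = 0.
Proof. by have /(congr1 (@complex.Re R)) := normr0 (bop H). Qed.

Lemma opnormN T : opnorm (- T) = opnorm T.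
Proof. by have /(congr1 (@complex.Re R)) := normrN T. Qed.

Lemma opnormB_le S T : opnorm (S - T) <= opnorm S + opnorm T.
Proof. by rewrite -(opnormN T) opnormD_le. Qed.

Lemma opnorm_scale (a : R[i]) T : opnorm (a *: T) = normc a * opnorm T.
Proof.
by apply/eqP; rewrite eq_le -!lecR !rmorphM /= opnormZ normcE lexx.
Qed.

Lemma opnormM_le S T : opnorm (S * T) <= opnorm S * opnorm T.
Proof.
apply: opnorm_le => [|x]; first by rewrite mulr_ge0 ?opnorm_ge0.
rewrite mulbE (le_trans (opnormP _ _))// rmorphM -mulrA ler_wpM2l ?opnormP//.
by rewrite lecR opnorm_ge0.
Qed.

Lemma opnorm_sum_le I (s : seq I) (P : pred I) (T : I -> bop H) :
  opnorm (\sum_(i <- s | P i) T i) <= \sum_(i <- s | P i) opnorm (T i).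
Proof.
elim/big_rec2: _ => [|i y S _ ih]; first by rewrite opnorm0.
by rewrite (le_trans (opnormD_le _ _))// lerD2l.
Qed.

Lemma opnorm_prod_le I (s : seq I) (T : I -> bop H) (C : R) : 0 <= C ->
  (forall i, opnorm (T i) <= C) -> opnorm (\prod_(i <- s) T i) <= C ^+ size s.
Proof.
move=> C0 TC; elim: s => [|i s ih].
  rewrite big_nil expr0; apply: opnorm_le => // x; by rewrite rmorph1 mul1r.
rewrite big_cons /= exprS (le_trans (opnormM_le _ _))//.
by rewrite ler_pM ?opnorm_ge0.
Qed.

Lemma ball_opnorm S T (e : R) : ball S e%:C T <-> opnorm (S - T) < e.
Proof. by rewrite -ball_normE /ball_ /= opnorm_normE ltcR. Qed.

Lemma lt0_complex (e : R[i]) : 0 < e -> exists2 r : R, 0 < r & e = r%:C.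
Proof.
move=> e0; have er : (complex.Re e)%:C = e by rewrite RRe_real// gtr0_real.
by exists (complex.Re e); rewrite // -ltcR er.
Qed.

(** Cauchy-Schwarz: [a] makes [u - a *: v] orthogonal to [v], and the square norm of that vector is
    nonnegative. *)
Lemma dot_le (u v : H) : `|dot u v| <= `|u| * `|v|.
Proof.
have [->|v0] := eqVneq v 0; first by rewrite linear0r !normr0 mulr0.
have v2_gt0 : 0 < `|v| ^+ 2 by rewrite exprn_gt0 ?normr_gt0.
have uvC x y : dot x y = Num.conj (dot y x).
  by rewrite hermC expr0 mul1r.
pose a := dot u v / `|v| ^+ 2.
have uav : dot (u - a *: v) v = 0.
  by rewrite linearBl /= linearZl_LR /= dotxx divfK ?subrr// gt_eqF.
have : 0 <= dot (u - a *: v) (u - a *: v) by rewrite dotxx exprn_ge0.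
rewrite linearBr /= linearZr_LR /= uav mulr0 subr0 linearBl /= linearZl_LR /=.
rewrite dotxx [dot v u]uvC /a mulrAC -normCK subr_ge0 ler_pdivrMr// -exprMn.
by rewrite ler_pXn2r ?nnegrE// mulr_ge0.
Qed.

Lemma linear_bound_continuous (f : H -> H) (M : R) : linear f ->
  (forall x, `|f x| <= M%:C * `|x|) -> continuous f.
Proof.
move=> lf fM; pose fL := GRing.isLinear.Build R[i] H H *:%R f lf.
pose g : {linear H -> H} := HB.pack f fL.
apply: (@bounded_linear_continuous _ _ _ g); apply/linear_boundedP.
exists M%:C; split=> [|r /ltW Mr h /=]; first by rewrite complex_real.
by rewrite (le_trans (fM h))// ler_wpM2r.
Qed.

                                                                             
(** Commuting with the rank-one operator [h |-> dot h v *: u] and evaluating at [v] gives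
    [dot v v *: T u = dot (T v) v *: u] for every [u]. *)
Lemma commutant_scalar T :
  (forall S, T * S = S * T) -> exists c : R[i], T = c *: (1 : bop H).
Proof.
move=> TC; have [[v v0]|H0] := pselect (exists v : H, v != 0); last first.
  exists 0; apply: bopP => x; have -> : x = 0.
    by apply: contrapT => /eqP x0; apply: H0; exists x.
  by rewrite !linear0.
have lin (u : H) : linear (fun h : H => dot h v *: u).
  by move=> a x y; rewrite linearPl /= scalerDl scalerA.
have cont (u : H) : continuous (fun h : H => dot h v *: u).
  apply: (linear_bound_continuous (lin u) (M := complex.Re (`|v| * `|u|))) => h.
  rewrite RRe_real ?realM ?normr_real// normrZ.
  by rewrite (le_trans (ler_wpM2r _ (dot_le h v)))// -mulrA mulrC.
have dv0 : dot v v != 0 by rewrite dotxx expf_eq0 normr_eq0.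
exists ((dot v v)^-1 * dot (T v) v); apply: bopP => u.
have := congr1 (fun S : bop H => S v) (TC (Bop (lin u) (cont u))).
rewrite !mulbE /= linearZ /= => /(congr1 (fun w => (dot v v)^-1 *: w)).
by rewrite !scalerA mulVf// scale1r.
Qed.

End OperatorCalculus.

(** * Block matrices transported by a unitary *)

Section Coordinates.
Context {R : realType} {H : hilbertType R}.

Lemma sumbE I (s : seq I) (P : pred I) (T : I -> bop H) x :
  (\sum_(i <- s | P i) T i) x = \sum_(i <- s | P i) T i x.
Proof. by elim/big_rec2: _ => // i y S _ <-. Qed.

Context {n : nat} (U : unitary H n).

Lemma ufun_sum I (s : seq I) (P : pred I) (u : I -> 'I_n -> H) :
  U (fun j => \sum_(i <- s | P i) u i j) = \sum_(i <- s | P i) U (u i).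
Proof.
pose fL := GRing.isLinear.Build R[i] ('I_n -> H) H *:%R U (ufun_linear U).
pose g : {linear ('I_n -> H) -> H} := HB.pack (U : ('I_n -> H) -> H) fL.
rewrite -[RHS](raddf_sum g) /=; congr (ufun U _); apply/funext => j.
by elim/big_rec2: _ => // i y v _ ->.
Qed.

Fact coord_in_linear (i : 'I_n) :
  linear (fun h => U (fun j => if j == i then h else 0)).
Proof.
move=> a x y; rewrite -ufun_linear; congr (ufun U _); apply/funext => j.
rewrite -[RHS]/((a *: (if j == i then x else 0) : H)
  + (if j == i then y else 0)).
by case: eqP => //; rewrite scaler0 addr0.
Qed.

Fact coord_in_le (i : 'I_n) h :
  `|U (fun j => if j == i then h else 0)| <= 1%:C * `|h|.
Proof.
rewrite rmorph1 mul1r (le_trans (unitary_norm_le _ _))// (bigD1 i)//= eqxx.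
by rewrite big1 ?addr0// => j /negPf ->; rewrite normr0.
Qed.

                                                                              
                                                                        
(** The isometry of [H] onto the [i]-th summand of H^(n), followed by [U]. With its adjoint
    [coord_out i] it turns block computations into products in [bop H]. *)
Definition coord_in i : bop H := Bop (coord_in_linear i)
  (linear_bound_continuous (coord_in_linear i) (coord_in_le i)).

Fact coord_out_linear (i : 'I_n) : linear (fun h => uadj U h i).
Proof. by move=> a x y; rewrite uadj_linear. Qed.

Fact coord_out_le (i : 'I_n) h : `|uadj U h i| <= 1%:C * `|h|.
Proof. by rewrite rmorph1 mul1r uadj_norm_le. Qed.

Definition coord_out i : bop H := Bop (coord_out_linear i)
  (linear_bound_continuous (coord_out_linear i) (coord_out_le i)).

Lemma coord_outin i j : coord_out i * coord_in j = (i == j)%:R.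
Proof.
by apply: bopP => x; rewrite mulbE /= ufunK; case: eqP.
Qed.

Lemma coord_sum : \sum_i coord_in i * coord_out i = 1.
Proof.
apply: bopP => x; rewrite sumbE -[RHS](uadjK U) /= -ufun_sum.
congr (ufun U _); apply/funext => j.
by rewrite (bigD1 j)//= eqxx big1 ?addr0// => i /negPf ij; rewrite eq_sym ij.
Qed.

Lemma coord_in_ext (S T : bop H) :
  (forall i, S * coord_in i = T * coord_in i) -> S = T.
Proof.
move=> ST; rewrite -[S]mulr1 -[T]mulr1 -coord_sum !mulr_sumr.
by apply: eq_bigr => i _; rewrite !mulrA ST.
Qed.

Lemma opconjE (T : 'M[bop H]_n) :
  opconj U T = \sum_i \sum_j coord_in i * T i j * coord_out j.
Proof.
apply: bopP => x; rewrite sumbE /=.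
under eq_bigr do rewrite sumbE -ufun_sum.
rewrite -ufun_sum; congr (ufun U _); apply/funext => i.
rewrite [RHS](bigD1 i)//= eqxx [X in _ + X]big1 ?addr0// => k /negPf ik.
by rewrite big1// => j _; rewrite eq_sym ik.
Qed.

Lemma opconj_in (T : 'M[bop H]_n) j :
  opconj U T * coord_in j = \sum_i coord_in i * T i j.
Proof.
rewrite opconjE mulr_suml; apply: eq_bigr => i _; rewrite mulr_suml.
rewrite (bigD1 j)//= -mulrA coord_outin eqxx mulr1 big1 ?addr0// => k kj.
by rewrite -mulrA coord_outin (negPf kj) mulr0.
Qed.

Lemma coord_out_opconj (T : 'M[bop H]_n) i :
  coord_out i * opconj U T = \sum_j T i j * coord_out j.
Proof.
rewrite opconjE mulr_sumr (bigD1 i)//= mulr_sumr.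
rewrite [X in _ + X]big1 ?addr0 => [|k ki]; last first.
  rewrite mulr_sumr big1// => j _.
  by rewrite !mulrA coord_outin eq_sym (negPf ki) !mul0r.
by apply: eq_bigr => j _; rewrite !mulrA coord_outin eqxx mul1r.
Qed.

Lemma opnorm_coord_in i : opnorm (coord_in i) <= 1.
Proof. by apply: opnorm_le => // x; exact: coord_in_le. Qed.

Lemma opnorm_coord_out i : opnorm (coord_out i) <= 1.
Proof. by apply: opnorm_le => // x; exact: coord_out_le. Qed.

Lemma opnorm_compression (T : bop H) i j :
  opnorm (coord_out i * T * coord_in j) <= opnorm T.
Proof.
rewrite (le_trans (opnormM_le _ _))// -[leRHS]mulr1 ler_pM ?opnorm_ge0//.
  rewrite (le_trans (opnormM_le _ _))// -[leRHS]mul1r ler_pM ?opnorm_ge0//.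
  exact: opnorm_coord_out.
exact: opnorm_coord_in.
Qed.

Lemma opnorm_opconj_le (T : 'M[bop H]_n) :
  opnorm (opconj U T) <= \sum_i \sum_j opnorm (T i j).
Proof.
rewrite opconjE (le_trans (opnorm_sum_le _ _ _))//; apply: ler_sum => i _.
rewrite (le_trans (opnorm_sum_le _ _ _))//; apply: ler_sum => j _.
rewrite (le_trans (opnormM_le _ _))// -[leRHS]mulr1 ler_pM ?opnorm_ge0//.
  rewrite (le_trans (opnormM_le _ _))// -[leRHS]mul1r ler_pM ?opnorm_ge0//.
  exact: opnorm_coord_in.
exact: opnorm_coord_out.
Qed.

Lemma opconjB (S T : 'M[bop H]_n) :
  opconj U S - opconj U T = opconj U (\matrix_(i, j) (S i j - T i j)).
Proof.
rewrite !opconjE -sumrB; apply: eq_bigr => i _.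
by rewrite -sumrB; apply: eq_bigr => j _; rewrite mxE mulrBr mulrBl.
Qed.

End Coordinates.

                                              

(** * Words, creation operators and intertwiners *)

Section WordEnumeration.

Fixpoint words_upto (d m : nat) : seq (seq 'I_d) :=
  if m is m'.+1 then
    [::] :: [seq r :: w | r <- enum 'I_d, w <- words_upto d m']
  else [:: [::]].

Lemma mem_words_upto d m w : (w \in words_upto d m) = (size w <= m)%N.
Proof.
elim: m w => [|m ih] [|r w] //=; rewrite inE orFb ltnS -ih.
apply/allpairsP/idP => [[[s v]] /= [_ vm [_ ->]] //|wm].
by exists (r, w); rewrite mem_enum.
Qed.

Lemma words_upto_uniq d m : uniq (words_upto d m).
Proof.
elim: m => //= m ih; apply/andP; split.
  by apply/allpairsP => -[[r w] /= [_ _]].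
apply: allpairs_uniq => //; first exact: enum_uniq.
by move=> [r w] [s v] _ _ /= [-> ->].
Qed.

                                                                           
                                                     
(** Longer words come first: prefixing a letter then lowers the index, which makes the creation
    operators upper triangular. *)
Lemma words_enumeration d m : exists N (W : 'I_N.+1 -> seq 'I_d),
  [/\ injective W, forall i, (size (W i) <= m)%N,
      forall w, (size w <= m)%N -> exists i, W i = w &
      forall i j, (size (W j) < size (W i))%N -> (i < j)%N].
Proof.
pose leT := [rel u v : seq 'I_d | (size v <= size u)%N].
pose s := sort leT (words_upto d m).
have sE w : (w \in s) = (size w <= m)%N by rewrite mem_sort mem_words_upto.
have s_uniq : uniq s by rewrite sort_uniq words_upto_uniq.
have s_size : size s = (size s).-1.+1.
  by rewrite prednK// -has_predT; apply/hasP; exists [::]; rewrite ?sE.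
have ltiN (i : 'I_(size s).-1.+1) : (i < size s)%N.
  by rewrite [ltnRHS]s_size ltn_ord.
exists (size s).-1, (fun i => nth [::] s i); split.
- move=> i j /eqP; rewrite nth_uniq ?ltiN// => /eqP ij; exact: val_inj.
- by move=> i; rewrite -sE mem_nth.
- move=> w; rewrite -sE => ws.
  have : (index w s < (size s).-1.+1)%N by rewrite -s_size index_mem.
  by move=> lt; exists (Ordinal lt); rewrite /= nth_index.
- move=> i j; apply: contraTT; rewrite -!leqNgt => ij.
  have leT_tr : transitive leT by move=> ? ? ? /= ab bc; exact: leq_trans bc ab.
  apply: (sorted_leq_nth leT_tr _ _ (sort_sorted _ _)); rewrite ?inE ?ltiN//.
    by move=> u; rewrite /= leqnn.
  by move=> u v; rewrite /= leq_total.
Qed.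

End WordEnumeration.

Section Intertwining.
Context {R : realType} {H : hilbertType R} {d : nat}.
Implicit Types (x : 'rV[bop H]_d) (a t : R[i]).

Definition scale_tuple a x : 'rV[bop H]_d := \row_r (a *: x 0 r).

                                                               
Definition tensor n (U : unitary H n) (T : 'M[R[i]]_n) x : 'rV[bop H]_d :=
  \row_r opconj U (\matrix_(i, j) (T i j *: x 0 r)).

Definition word_eval x (w : seq 'I_d) : bop H := \prod_(i <- w) x 0 i.

Context (Omega : set 'rV[bop H]_d) (F : 'rV[bop H]_d -> bop H).
Hypothesis F_intertwining : intertwining_preserving Omega F.

(** As [v] is an eigenvector of [T], the column [L] of scalar blocks [v j] intertwines [a x] with
    [tensor U T x]. The conclusion is row [i] of the resulting identity for [F]. *)
Lemma tensor_eigenvector n (U : unitary H n) (T : 'M[R[i]]_n) x a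
    (v : 'I_n -> R[i]) :
    (forall i, \sum_j T i j * v j = a * v i) ->
    Omega (tensor U T x) -> Omega (scale_tuple a x) ->
  forall i, v i *: F (scale_tuple a x) =
    \sum_j v j *: (coord_out U i * F (tensor U T x) * coord_in U j).
Proof.
move=> Tv OX Oax i; pose L := \sum_j v j *: coord_in U j.
have /(congr1 ( *%R (coord_out U i))) : L * F (scale_tuple a x) =
  F (tensor U T x) * L.
  apply: F_intertwining => // r; rewrite !mxE /L mulr_suml mulr_sumr.
  under eq_bigr do rewrite mulbZl mulbZr scalerA mulrC -Tv scaler_suml.
  under [RHS]eq_bigr do rewrite mulbZr opconj_in scaler_sumr.
  rewrite [RHS]exchange_big; apply: eq_bigr => k _; apply: eq_bigr => j _.
  by rewrite mxE mulbZr scalerA mulrC.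
rewrite mulrA /L mulr_sumr mulr_suml (bigD1 i)//= mulbZr mulbZl coord_outin
  eqxx.
rewrite mul1r big1 ?addr0 => [->|k ki]; last first.
  by rewrite mulbZr coord_outin eq_sym (negPf ki) scaler0 mul0r.
by rewrite !mulr_sumr; apply: eq_bigr => j _; rewrite !mulbZr !mulrA.
Qed.

Section Fock.
Context {N m : nat} (U : unitary H N.+1) (W : 'I_N.+1 -> seq 'I_d).
Hypotheses (W_inj : injective W) (W_le : forall i, (size (W i) <= m)%N).
Hypothesis W_onto : forall w, (size w <= m)%N -> exists i, W i = w.

                                                                         
                                                               
(** The left creation operators of the Fock space, truncated at length [m]: letter [r] sends the
    basis vector of [w] to [t] times that of [r :: w], or to 0 when [r :: w] is too long. *)
Definition creation t : 'rV[bop H]_d :=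
  \row_r opconj U
    (\matrix_(i, j) ((if W i == r :: W j then t else 0) *: (1 : bop H))).

(** The blocks of [creation t] are scalar, so it commutes with the diagonal copy [L] of any [S].
    Hence so does its image under [F], and each block of that image commutes with all of [bop H]. *)
Lemma creation_compression t i j : Omega (creation t) ->
  exists c : R[i], coord_out U i * F (creation t) * coord_in U j
    = c *: (1 : bop H).
Proof.
move=> Ot; apply: commutant_scalar => S;
  pose L := opconj U (diag_mx (\row_k S)).
have LinE k : L * coord_in U k = coord_in U k * S.
  rewrite /L opconj_in (bigD1 k)//= !mxE eqxx big1 ?addr0// => l lk.
  by rewrite !mxE (negPf lk) mulr0.
have outLE k : coord_out U k * L = S * coord_out U k.
  rewrite /L coord_out_opconj (bigD1 k)//= !mxE eqxx big1 ?addr0// => l lk.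
  by rewrite !mxE eq_sym (negPf lk) mul0r.
have LF : L * F (creation t) = F (creation t) * L.
  apply: F_intertwining => // r; rewrite !mxE.
  apply: (@coord_in_ext _ _ _ U) => k.
  rewrite -[RHS]mulrA LinE mulrA -[LHS]mulrA !opconj_in mulr_sumr mulr_suml.
  apply: eq_bigr => l _; rewrite mulrA LinE -!mulrA; congr (_ * _).
  by rewrite !mxE mulbZr mulbZl mulr1 mul1r.
by rewrite -!mulrA -LinE [F _ * _]mulrA -LF -mulrA [coord_out U i * _]mulrA
  outLE -mulrA.
Qed.

                                                                          
                                                                             
                              
(** The intertwiner [L] maps the summand of a word [w] to the summand [m - size w] by
    [(e / t) ^+ size w] times the monomial of [w] at [x]: prefixing a letter with weight [t]
    corresponds to shifting down with weight [e] and multiplying by a coordinate of [x]. The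
    identity for [F] is then read on the empty word, which [L] places in summand [m]. *)
Lemma tensor_creation n (V : unitary H n.+1) (T : 'M[R[i]]_n.+1) x (e t : R[i])
    (i0 : 'I_N.+1) (c : 'I_N.+1 -> R[i]) :
    (m <= n)%N ->
    (forall i j : 'I_n.+1, (j <= m)%N -> T i j = if i.+1 == j then e else 0) ->
    t != 0 -> W i0 = [::] ->
    (forall i, coord_out U i * F (creation t) * coord_in U i0 = c i *: (1 :
      bop H)) ->
    Omega (creation t) -> Omega (tensor V T x) ->
  coord_out V ord0 * F (tensor V T x) * coord_in V (inord m) =
    e ^+ m *: \sum_(i | size (W i) == m) (t ^- m * c i) *: word_eval x (W i).
Proof.
move=> mn TE t0 Wi0 cE Ot OX.
have mkn k : (m - k < n.+1)%N by rewrite ltnS (leq_trans (leq_subr _ _)).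
have {}TE i k : T i (inord (m - k)) = if i.+1 == (m - k)%N then e else 0.
  by rewrite TE ?inordK// leq_subr.
pose L := \sum_i ((e / t) ^+ size (W i)) *:
  (coord_in V (inord (m - size (W i))) * word_eval x (W i) * coord_out U i).
have /(congr1 (fun S => coord_out V ord0 * (S * coord_in U i0))) :
    L * F (creation t) = F (tensor V T x) * L.
  apply: F_intertwining => // r; rewrite !mxE /L mulr_suml mulr_sumr.
  under eq_bigr do rewrite mulbZl -mulrA coord_out_opconj mulr_sumr scaler_sumr.
  rewrite exchange_big; apply: eq_bigr => j _ /=.
  (* A word of full length [m] is killed on both sides: it has no successor, and it lands in summand
     0, whose column of [T] vanishes. *)
  rewrite mulbZr !mulrA opconj_in; have := W_le j;
    rewrite leq_eqVlt => /orP[/eqP Wjm|Wjm].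
    rewrite [LHS]big1 => [|i _]; last first.
      rewrite !mxE; case: eqP => [Wij|_]; last by rewrite scale0r mul0r mulr0
        scaler0.
      by have := W_le i; rewrite Wij /= Wjm ltnn.
    rewrite big1 ?mul0r ?scaler0// => i _.
    by rewrite mxE TE Wjm subnn scale0r mulr0.
  have [k Wk] := W_onto (w := r :: W j) Wjm.
  rewrite (bigD1 k)//= [X in _ + X = _]big1 ?addr0 => [|i ik]; last first.
    rewrite !mxE; case: eqP => [|_]; last by rewrite scale0r mul0r mulr0
      scaler0.
    by rewrite -Wk => /W_inj /eqP; rewrite (negPf ik).
  have -> : \sum_i coord_in V i *
      (\matrix_(i1, j0) (T i1 j0 *: x 0 r)) i (inord (m - size (W j))) =
      e *: (coord_in V (inord (m - (size (W j)).+1)) * x 0 r).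
    rewrite (bigD1 (inord (m - (size (W j)).+1)))//= big1 => [|i ik].
      by rewrite addr0 mxE TE inordK// -subSn// subSS eqxx mulbZr.
    rewrite mxE TE; case: eqP => [ij|_]; last by rewrite scale0r mulr0.
    by case/eqP: ik; apply/val_inj; rewrite /= inordK// subnS -ij.
  rewrite !mxE Wk eqxx /= mulbZl mulbZr mul1r !mulbZl !scalerA.
  rewrite /word_eval big_cons !mulrA exprSr; congr (_ *: _).
  by rewrite -!mulrA mulVf// mulr1.
have Lin : L * coord_in U i0 = coord_in V (inord m).
  rewrite /L mulr_suml (bigD1 i0)//= mulbZl -mulrA coord_outin eqxx mulr1.
  rewrite Wi0 /= expr0 scale1r subn0 /word_eval big_nil mulr1 big1 ?addr0// =>
    i ii0.
  by rewrite mulbZl -mulrA coord_outin (negPf ii0) mulr0 scaler0.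
rewrite -[F (tensor V T x) * L * _]mulrA Lin => CE; rewrite -mulrA -{}CE.
rewrite /L !mulr_suml mulr_sumr scaler_sumr [RHS]big_mkcond /=.
apply: eq_bigr => i _; rewrite !mulbZl mulbZr -!mulrA [coord_out U i * _]mulrA
  cE.
rewrite !mulbZr mulr1 mulrA coord_outin.
(* Block row 0 retains exactly the words of length [m]. *)
have -> : (ord0 == inord (m - size (W i)) :> 'I_n.+1) = (size (W i) == m).
  rewrite -val_eqE /= inordK// eq_sym subn_eq0.
  by rewrite eqn_leq W_le.
case: eqP => [->|_]; last by rewrite mul0r !scaler0.
by rewrite mul1r !scalerA exprMn exprVn mulrA.
Qed.

End Fock.
End Intertwining.

                                                   

(** * A discrete Cauchy estimate *)

Section CircleMeans.
Context {R : realType}.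

Lemma ler_archi (x y A : R) : (forall n, x <= y + A / n.+1%:R) -> x <= y.
Proof.
move=> xy; apply/ler_addgt0Pr => e e0.
have [n An] : exists n : nat, A / n.+1%:R <= e.
  exists (Num.truncn (A / e)); rewrite ler_pdivrMr// mulrC -ler_pdivrMr//.
  by rewrite ltW// truncnS_gt.
by rewrite (le_trans (xy n))// lerD2l.
Qed.

Definition cis (t : R) : R[i] := Complex (cos t) (sin t).

Lemma cis_exp t n : cis t ^+ n = cis (t *+ n).
Proof.
elim: n => [|n ih]; first by rewrite expr0 mulr0n /cis cos0 sin0.
rewrite exprS ih mulrS /cis cosD sinD; apply/eqP; rewrite eq_complex /=.
by rewrite eqxx /= addrC mulrC [cos t * _]mulrC.
Qed.

Lemma normc_cis t : normc (cis t) = 1.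
Proof. by rewrite /= cos2Dsin2 sqrtr1. Qed.

(** Take [z] and [w] of arguments [pi / N] and [2 pi / N]. The points [z w^j] are the roots of order
    [N] of -1, that is, the roots of unity turned by half a step, and [w - 1] has modulus
    [2 |sin (pi / N)|]. *)
Lemma fine_roots_of_unity (e : R) (N0 : nat) : 0 < e ->
  exists N (z w : R[i]), [/\ (N0 < N)%N, normc z = 1 /\ normc w = 1,
    z ^+ N = -1 /\ w ^+ N = 1, forall m, (0 < m < N)%N -> w ^+ m != 1 &
    normc (w - 1) <= e].
Proof.
move=> e0.
have : (fun n => sin (pi * (n.+1%:R)^-1 : R)) @ \oo --> sin (0 : R).
  have piN : (fun n => pi * (n.+1%:R)^-1 : R) @ \oo --> (0 : R).
    rewrite -[X in _ --> X](mulr0 pi); apply: cvgMr; exact: cvg_harmonic.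
  by apply: (cvg_comp _ _ piN); exact: continuous_sin.
rewrite sin0 => /cvgrPdist_le /(_ (e / 2));
  rewrite divr_gt0// => /(_ isT)[M _ MP].
pose N := (maxn N0 M).+2; pose t : R := pi / N%:R.
have tN : t *+ N = pi by rewrite -mulr_natr divfK// pnatr_eq0.
have z1 : cis t ^+ N = -1.
  by rewrite cis_exp tN /cis cospi sinpi; apply/eqP;
    rewrite eq_complex /= oppr0 !eqxx.
exists N, (cis t), (cis t ^+ 2); split.
- by rewrite /N ltnS leqW// leq_maxl.
- by rewrite normcX normc_cis expr1n.
- by rewrite exprAC z1 sqrrN expr1n.
- move=> m /andP[m0 mN]; rewrite -exprM mulnC exprM cis_exp cis_exp.
  apply/eqP => /(congr1 (@complex.Re R)) /=; rewrite cos_mulr2n => c1.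
  have : 0 < sin (t *+ m).
    apply: sin_gt0_pi; rewrite pmulrn_lgt0// divr_gt0 ?pi_gt0 ?ltr0n//=.
    by rewrite -tN ltr_pMn2l// divr_gt0 ?pi_gt0 ?ltr0n.
  move=> s0; have := cos2Dsin2 (t *+ m).
  have : 0 < sin (t *+ m) ^+ 2 by rewrite exprn_gt0.
  move: c1; lra.
- have -> : cis t ^+ 2 - 1 = cis t * Complex 0 (sin t *+ 2).
    apply/eqP; rewrite eq_complex /=; apply/andP; split; apply/eqP.
      by have := cos2Dsin2 t; rewrite !expr2; lra.
    lra.
  rewrite normcMr normc_cis mul1r /= expr0n add0r sqrtr_sqr normrMn.
  have : `|sin t| <= e / 2.
    by have := MP N.-1; rewrite /= sub0r normrN; apply; rewrite leqW// leq_maxr.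
  by rewrite ler_pdivlMr// mulr_natr.
Qed.

End CircleMeans.

Section MeanValue.
Context {R : realType} {H : hilbertType R}.

                                                                                
                                                                              
                                                                                
                                 
(** A discrete mean value property, with the second-order bound [C] in place of holomorphy. When the
    radius grows, the radial increments are, up to second order, a fixed multiple of the increments
    along the circle, and the latter telescope to 0. Near radius 0 the bound by [L] makes the sum
    negligible. *)
Lemma circle_mean_le (N : nat) (z w : R[i]) (rad C L : R) (P : R[i] -> Prop)
    (K : R[i] -> bop H) :
    0 < rad -> 0 <= C -> normc z = 1 -> normc w = 1 -> w ^+ N = 1 -> w != 1 ->
    (forall r j, 0 < r <= rad -> P (r%:C * (z * w ^+ j))) ->
    (forall a b c, P a -> P b -> P c -> exists c1 c2 : bop H,
      [/\ opnorm c2 <= C, K b = K a + (b - a) *: c1 &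
          K c = K a + (c - a) *: c1 + ((c - a) * (c - b)) *: c2]) ->
    (forall a, P a -> opnorm (K a) <= L * normc a) ->
  opnorm (\sum_(0 <= j < N) K (rad%:C * (z * w ^+ j)))
    <= N%:R * (C * rad ^+ 2 * normc (w - 1)).
Proof.
move=> rad0 C0 z1 w1 wN w_neq1 PP K2 KL.
pose S r := \sum_(0 <= j < N) K (r%:C * (z * w ^+ j)).
have zw1 j : normc (z * w ^+ j) = 1 by rewrite normcMr normcX z1 w1 expr1n
  mulr1.
have step r s : 0 < r -> 0 <= s -> r + s <= rad ->
    opnorm (S (r + s)) <= opnorm (S r) + N%:R * (C * s * (s + rad * normc (w -
      1))).
  (* [k] is the radial increment over the tangential one; it is the same at every node. *)
  move=> r0 s0 rs; pose k : R[i] := s%:C / (r%:C * (w - 1)).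
  have telescope : \sum_(0 <= j < N) k *: (K (r%:C * (z * w ^+ j.+1)) - K (r%:C
    * (z * w ^+ j))) = 0.
    rewrite -scaler_sumr (telescope_sumr (fun j => K (r%:C * (z * w ^+ j))))//.
    by rewrite wN expr0 subrr scaler0.
  rewrite -lerBlDl (le_trans _ (_ : opnorm (S (r + s) - S r) <= _))//.
    by rewrite lerBlDr -[in leLHS](subrK (S r) (S (r + s))) opnormD_le.
  rewrite -[S (r + s) - S r]subr0 -telescope /S -!sumrB.
  rewrite (le_trans (opnorm_sum_le _ _ _))//.
  rewrite mulr_natl -[X in _ *+ X]subn0 -sumr_const_nat;
    apply: ler_sum_nat => j _.
  pose a := r%:C * (z * w ^+ j); pose b := r%:C * (z * w ^+ j.+1).
  pose c := (r + s)%:C * (z * w ^+ j); rewrite -/a -/b -/c.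
  have [||| c1 [c2 [c2C -> ->]]] := K2 a b c.
  - by apply: PP; rewrite r0 (le_trans _ rs)// lerDl.
  - by apply: PP; rewrite r0 (le_trans _ rs)// lerDl.
  - by apply: PP; rewrite rs ltr_wpDr.
  have ca : c - a = s%:C * (z * w ^+ j) by rewrite /c /a rmorphD /= -mulrBl
    addrC addKr.
  have ba : b - a = (r%:C * (w - 1)) * (z * w ^+ j) by rewrite /a /b exprS;
    ring.
  have kba : k * (b - a) = c - a.
    rewrite ba ca /k mulrA divfK// mulf_neq0 ?subr_eq0//.
    by rewrite fmorph_eq0 gt_eqF.
  (* Since [k * (b - a) = c - a], the first-order terms cancel and only the term in [c2] remains. *)
  rewrite [K a + _ - _]addrAC subrr add0r scalerA kba.
  rewrite -[K a + _ + _]addrA [K a + _]addrC addrK addrAC subrr add0r.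
  rewrite opnorm_scale normcMr ca normcMr zw1 mulr1 normc_real ger0_norm//.
  have cb : normc (c - b) <= s + rad * normc (w - 1).
    have -> : c - b = (c - a) - (b - a) by rewrite opprB addrA subrK.
    rewrite (le_trans (normcD_le _ _))// normcNr ca ba.
    rewrite normcMr zw1 mulr1 normcMr zw1 mulr1 normcMr.
    rewrite !normc_real ger0_norm// ger0_norm ?(ltW r0)//
      lerD2l ler_wpM2r ?normc_ge0//.
    by rewrite (le_trans _ rs)// lerDl.
  rewrite mulrC mulrA ler_pM ?mulr_ge0 ?opnorm_ge0 ?normc_ge0//.
  by rewrite ler_wpM2r.
set D := normc (w - 1) in step *; have D0 : 0 <= D := normc_ge0 _.
(* The radius [rad] is reached from [s] in [n] steps of length [s = rad / n.+1]; the excess over the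
   claimed bound is of order [1 / n.+1]. *)
apply: (@ler_archi _ _ _ (N%:R * (L * rad + C * rad ^+ 2))) => n.
pose s := rad / n.+1%:R; have s0 : 0 < s by rewrite divr_gt0.
have sn : s * n.+1%:R = rad by rewrite divfK// pnatr_eq0.
have ih m : (m <= n)%N -> opnorm (S (s * m.+1%:R)) <=
    N%:R * (L * s) + m%:R * (N%:R * (C * s * (s + rad * D))).
  elim: m => [_|m ih mn].
    rewrite mul0r addr0 mulr1 (le_trans (opnorm_sum_le _ _ _))//.
    rewrite mulr_natl -[X in _ *+ X]subn0 -sumr_const_nat;
      apply: ler_sum_nat => j _.
    have s_rad : 0 < s <= rad by rewrite s0 -sn ler_peMr ?(ltW s0)// ler1n.
    by rewrite (le_trans (KL _ (PP _ _ s_rad)))//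
      normcMr zw1 mulr1 normc_real gtr0_norm.
  have -> : s * m.+2%:R = s * m.+1%:R + s by rewrite -[m.+2%:R]natr1 mulrDr
    mulr1.
  apply: (le_trans (step _ s _ (ltW s0) _)); first by rewrite mulr_gt0.
    by rewrite -[X in _ + X]mulr1 -mulrDr natr1 -[leRHS]sn ler_pM2l// ler_nat.
  by rewrite -[in leRHS]natr1 [(_ + 1) * _]mulrDl mul1r addrA lerD2r ih// ltnW.
have := ih n (leqnn n); rewrite sn => /le_trans; apply.
rewrite -subr_ge0.
have -> : N%:R * (C * rad ^+ 2 * D) + N%:R * (L * rad + C * rad ^+ 2) / n.+1%:R
  -
  (N%:R * (L * s) + n%:R * (N%:R * (C * s * (s + rad * D)))) =
  N%:R * C * s * (s + rad * D).
  have ns : n%:R * s = rad - s by rewrite -sn -natr1; ring.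
  have -> : n%:R * (N%:R * (C * s * (s + rad * D))) =
    n%:R * s * (N%:R * C * (s + rad * D)) by ring.
  have -> : N%:R * (L * rad + C * rad ^+ 2) / n.+1%:R =
    N%:R * (L * s + C * s * rad).
    by rewrite /s; ring.
  by rewrite ns; ring.
have [s_ge0 rad_ge0] := (ltW s0, ltW rad0); apply: mulr_ge0.
  by apply: mulr_ge0 => //; exact: mulr_ge0.
by apply: addr_ge0 => //; exact: mulr_ge0.
Qed.
End MeanValue.

Section CauchyEstimate.
Context {R : realType} {H : hilbertType R}.

Lemma root_of_unity_sum (F : fieldType) (N : nat) (x : F) :
  x ^+ N = 1 -> x != 1 -> \sum_(0 <= j < N) x ^+ j = 0.
Proof.
move=> xN x1; have x10 : x - 1 != 0 by rewrite subr_eq0.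
by apply: (mulfI x10); rewrite big_mkord -subrX1 xN subrr mulr0.
Qed.

Section NodesOnCircle.
Context (F : fieldType) (N : nat) (a w : F).
Hypotheses (wN : w ^+ N = 1) (w_prim : forall m, (0 < m < N)%N -> w ^+ m != 1).
Hypotheses (w0 : w != 0) (a0 : a != 0) (aN : a ^+ N != 1).

Lemma sum_nodes_exp p : (0 < p < N)%N -> \sum_(0 <= j < N) (a * w ^+ j) ^+ p =
  0.
Proof.
move=> pN; under eq_bigr do rewrite exprMn -exprM mulnC exprM.
by rewrite -mulr_sumr root_of_unity_sum ?mulr0// ?w_prim// exprAC wN expr1n.
Qed.

Lemma sum_nodes_expN p : (0 < p < N)%N -> \sum_(0 <= j < N) (a * w ^+ j) ^- p =
  0.
Proof.
move=> pN; have E j : (a * w ^+ j) ^- p = a ^- p * (w ^- p) ^+ j.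
  by rewrite exprMn invfM exprVn -!exprM mulnC.
under eq_bigr do rewrite E.
rewrite -mulr_sumr root_of_unity_sum ?mulr0//.
  by rewrite exprVn exprAC wN expr1n invr1.
by rewrite invr_eq1 w_prim.
Qed.

Lemma node_expN j : (a * w ^+ j) ^+ N = a ^+ N.
Proof. by rewrite exprMn exprAC wN expr1n mulr1. Qed.

Lemma node_neq1 j : a * w ^+ j != 1.
Proof.
by apply: contraNneq aN => aj1; rewrite -(node_expN j) aj1 expr1n.
Qed.

(** For [p = 0], write [1 / (l - 1)] as the geometric sum of the [l ^+ i] over [l ^+ N - 1]; only
    [i = 0] survives the sum over nodes. Raising [p] by one subtracts the sum of the [l ^- p.+1],
    which is 0. *)
Lemma sum_nodes_pole p : (p < N)%N ->
  \sum_(0 <= j < N) ((a * w ^+ j) ^+ p * (a * w ^+ j - 1))^-1 =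
    N%:R / (a ^+ N - 1).
Proof.
have aN10 : a ^+ N - 1 != 0 by rewrite subr_eq0.
have l10 j : a * w ^+ j - 1 != 0 by rewrite subr_eq0 node_neq1.
have l0 j : a * w ^+ j != 0 by rewrite mulf_neq0// expf_neq0.
elim: p => [|p ih] pN.
  have E j : ((a * w ^+ j) ^+ 0 * (a * w ^+ j - 1))^-1 =
      (\sum_(0 <= i < N) (a * w ^+ j) ^+ i) / (a ^+ N - 1).
    rewrite expr0 mul1r; apply: (mulfI (l10 j)).
    by rewrite divff// mulrA big_mkord -subrX1 node_expN divff.
  under eq_bigr do rewrite E.
  rewrite -mulr_suml exchange_big /=; congr (_ / _).
  have S0 : \sum_(1 <= p < N) \sum_(0 <= j < N) (a * w ^+ j) ^+ p = 0.
    by rewrite (eq_big_nat _ _ sum_nodes_exp) big1.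
  rewrite big_ltn// S0 addr0.
  by under eq_bigr do rewrite expr0; rewrite sumr_const_nat subn0.
rewrite -ih ?(ltnW pN)//; apply/eqP; rewrite -subr_eq0 -sumrB.
under eq_bigr => j _.
  rewrite (_ : _ - _ = - (a * w ^+ j) ^- p.+1); last first.
    have := l0 j; have := l10 j; set l := a * w ^+ j => {}l10 {}l0.
    by rewrite exprS; field; rewrite l10 l0 expf_neq0.
  over.
by rewrite sumrN sum_nodes_expN ?oppr0.
Qed.

End NodesOnCircle.

Lemma natr_le_expr (x : R) n : 1 < x -> n%:R * (x - 1) <= x ^+ n.
Proof.
move=> x1; elim: n => [|n ih]; first by rewrite mul0r expr0.
rewrite -natr1 mulrDl mul1r exprS.
have : 1 <= x ^+ n by rewrite exprn_ege1// ltW.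
move: x1 ih; set y := x ^+ n; set u := n%:R * _; nra.
Qed.

                                                                               
                                                                              
                                
(** The bound is the one given by Cauchy's formula, where [rho] is the integral of
    [g l / (l ^+ k * (l - 1))] over the circle of radius [rad], divided by [2 i pi]. A mean over [N]
    nodes replaces the integral, and the bounded divided differences [h0], [h1], [h2] replace
    holomorphy. *)
Lemma cauchy_remainder (g : R[i] -> bop H) (a : nat -> bop H) (k : nat)
    (rad M C : R) (rho := g 1 - \sum_(m < k) a m) :
    1 < rad -> (forall l, normc l <= rad -> opnorm (g l) <= M) ->
    (forall x y z, normc x <= rad -> normc y <= rad -> normc z <= rad ->
      exists h0 h1 h2 : bop H,
        [/\ opnorm h0 <= C, opnorm h1 <= C, opnorm h2 <= C &
        forall l, [\/ l = x, l = y | l = z] ->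
          g l = \sum_(m < k) l ^+ m *: a m + l ^+ k *: rho +
            (l ^+ k * (l - 1)) *:
              (h0 + (l - x) *: h1 + ((l - x) * (l - y)) *: h2)]) ->
  opnorm rho <= rad * M / (rad - 1) / rad ^+ k.
Proof.
move=> rad1 gM gC; have rhoE : g 1 = \sum_(m < k) a m + rho.
  by rewrite addrC subrK.
clearbody rho; have rad0 : 0 < rad by rewrite (lt_trans _ rad1).
have C0 : 0 <= C.
  have r0 : normc 0 <= rad by rewrite (eqP (_ : normc 0 == 0)) ?normc_eq0 ?ltW.
  have [h0 [h1 [h2 [+ _ _ _]]]] := gC _ _ _ r0 r0 r0.
  by apply: le_trans; exact: opnorm_ge0.
have M0 : 0 <= M.
  rewrite (le_trans _ (gM 0 _)) ?opnorm_ge0//.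
  by rewrite (eqP (_ : normc 0 == 0)) ?normc_eq0 ?ltW.
pose P (l : R[i]) := [/\ normc l <= rad, l != 0 & l != 1].
(* The extra factor [l] comes from [dl = i l d theta], and makes [K] vanish to first order at 0. *)
pose K (l : R[i]) := (l / (l ^+ k * (l - 1))) *:
  (g l - \sum_(m < k) l ^+ m *: a m - l ^+ k *: rho).
have KE l h : P l -> g l = \sum_(m < k) l ^+ m *: a m + l ^+ k *: rho +
    (l ^+ k * (l - 1)) *: h -> K l = l *: h.
  move=> [_ l0 l1] gl; rewrite /K gl -[_ - _ - _]addrA -opprD [_ + _ *: h]addrC
    addrK.
  by rewrite scalerA divfK// mulf_neq0 ?expf_neq0// subr_eq0.
have K2 x y z : P x -> P y -> P z -> exists c1 c2 : bop H,
    [/\ opnorm c2 <= (1 + rad) * C, K y = K x + (y - x) *: c1 &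
        K z = K x + (z - x) *: c1 + ((z - x) * (z - y)) *: c2].
  move=> Px Py Pz; have [xr _ _] := Px; have [yr _ _] := Py;
    have [zr _ _] := Pz.
  have [h0 [h1 [h2 [_ h1C h2C hE]]]] := gC _ _ _ xr yr zr.
  rewrite (KE x _ Px (hE _ _)) ?(KE y _ Py (hE _ _)) ?(KE z _ Pz (hE _ _));
    [|by constructor..].
  (* These are the divided differences of [l |-> l h(l)], for [h] the quadratic Newton polynomial
     with coefficients [h0], [h1], [h2]. *)
  exists (h0 + y *: h1), (h1 + z *: h2); split.
  - rewrite mulrDl mul1r (le_trans (opnormD_le _ _))// lerD// opnorm_scale.
    by rewrite ler_pM ?normc_ge0 ?opnorm_ge0.
  - rewrite !subrr !mul0r mulr0 !scale0r !addr0 !scalerDr !scalerA addrA.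
    by rewrite -scalerDl [x + _]addrC subrK mulrC.
  - rewrite !subrr !mul0r !scale0r !addr0 !scalerDr !scalerA !addrA.
    rewrite -scalerDl [x + _]addrC subrK -[z *: h0 + _ + _ *: h1]addrA
      -scalerDl.
    by congr (_ + _ *: h1 + _ *: h2); ring.
have KL x : P x -> opnorm (K x) <= C * normc x.
  move=> Px; have [xr _ _] := Px.
  have [h0 [h1 [h2 [h0C _ _ hE]]]] := gC _ _ _ xr xr xr.
  rewrite (KE x _ Px (hE _ _)); last by constructor.
  rewrite subrr mul0r !scale0r !addr0 opnorm_scale mulrC ler_wpM2r//.
  exact: normc_ge0.
apply: (@ler_archi _ _ _ (M / (rad - 1) + (1 + rad) * C * rad ^+ 2)) => n.
have [|N [z [w [nN [z1 w1] [zN wN] w_prim w_le]]]] :=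
  @fine_roots_of_unity R (n.+1%:R^-1) (maxn k n.+1); first by rewrite invr_gt0.
move: nN; rewrite gtn_max => /andP[kN nN].
pose A := rad%:C * z; have AE j : rad%:C * (z * w ^+ j) =
  A * w ^+ j by rewrite mulrA.
have N0 : (0 < N)%N by case: (N) kN.
have w1' : w != 1 by rewrite -[w]expr1 w_prim// (leq_ltn_trans _ nN).
have AN : A ^+ N = - (rad ^+ N)%:C by rewrite /A exprMn zN mulrN1 -rmorphXn.
have z0 : z != 0 by rewrite -normc_eq0 z1 oner_eq0.
have w0 : w != 0 by rewrite -normc_eq0 w1 oner_eq0.
have A0 : A != 0 by rewrite mulf_neq0// -normc_eq0 normc_real normr_eq0 gt_eqF.
have normAN1 : normc (A ^+ N - 1) = rad ^+ N + 1.
  rewrite AN -opprD normcNr -[1]/(1%:C) -rmorphD normc_real ger0_norm//.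
  by rewrite addr_ge0// exprn_ge0// ltW.
have AN1 : A ^+ N != 1.
  by rewrite -subr_eq0 -normc_eq0 normAN1 gt_eqF// addr_gt0// exprn_gt0.
(* At any radius [r] a node has [N]-th power [- r ^+ N], since [z ^+ N = -1]; so no node meets the
   pole 1. *)
have nodeP r j : 0 < r <= rad -> P (r%:C * (z * w ^+ j)).
  move=> /andP[r0 rr]; split.
  - by rewrite !normcMr normcX z1 w1 expr1n !mulr1 normc_real gtr0_norm.
  - by rewrite !mulf_neq0 ?expf_neq0// -normc_eq0 normc_real normr_eq0 gt_eqF.
  apply/eqP => /(congr1 (fun x => x ^+ N));
    rewrite expr1n mulrA (node_expN _ wN).
  rewrite exprMn zN mulrN1 -rmorphXn => /(congr1 (@complex.Re R)) /= /eqP.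
  by rewrite lt_eqF// (@lt_trans _ _ 0)// oppr_lt0 exprn_gt0.
have := circle_mean_le rad0 _ z1 w1 wN w1' nodeP K2 KL.
rewrite mulr_ge0 ?addr_ge0 ?(ltW rad0)// => /(_ isT) KN.
(* With the weights [c j], the powers below [k] sum to [t] and the power [k] to [N + t]; exact
   residues would give 0 and [N]. The error [t] is negligible against [N] because [rad ^+ N] is
   large. *)
pose t : R[i] := N%:R / (A ^+ N - 1).
pose l j := A * w ^+ j; pose c j := l j / (l j ^+ k * (l j - 1)).
pose G := \sum_(0 <= j < N) c j *: g (l j).
have l0 j : l j != 0 by rewrite mulf_neq0 ?expf_neq0.
have l10 j : l j - 1 != 0 by rewrite subr_eq0 (node_neq1 wN).
have pole p : (p < N)%N -> \sum_(0 <= j < N) (l j ^+ p * (l j - 1))^-1 = t.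
  exact: sum_nodes_pole wN w_prim w0 A0 AN1 p.
have c_lt m : (m < k)%N -> \sum_(0 <= j < N) c j * l j ^+ m = t.
  move=> mk; rewrite -(pole (k - m.+1)%N); last first.
    by rewrite (leq_ltn_trans (leq_subr _ _)).
  apply: eq_bigr => j _; rewrite /c -[in l j ^+ k](subnK mk) exprD exprS.
  by field; rewrite !expf_neq0 ?l0 ?l10.
have c_eq : \sum_(0 <= j < N) c j * l j ^+ k = N%:R + t.
  rewrite -(pole 0)//.
  have -> : N%:R = \sum_(0 <= j < N) 1 :> R[i] by rewrite sumr_const_nat subn0.
  rewrite -big_split /=.
  apply: eq_bigr => j _; rewrite /c expr0 mul1r.
  by field; rewrite expf_neq0 ?l0 ?l10.
have KsumE : \sum_(0 <= j < N) K (rad%:C * (z * w ^+ j)) =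
    G - t *: g 1 - N%:R *: rho.
  have KlE j : K (rad%:C * (z * w ^+ j)) = c j *: g (l j) -
      \sum_(m < k) (c j * l j ^+ m) *: a m - (c j * l j ^+ k) *: rho.
    rewrite AE /K -/(l j) -/(c j) !scalerBr scalerA; congr (_ - _ - _).
    by rewrite scaler_sumr; apply: eq_bigr => m _; rewrite scalerA.
  under eq_bigr do rewrite KlE.
  rewrite !sumrB exchange_big /= -scaler_suml c_eq.
  under [X in _ - X - _]eq_bigr => m _ do rewrite -scaler_suml c_lt//.
  rewrite -scaler_sumr -/G scalerDl -!addrA -!opprD; congr (_ - _).
  by rewrite rhoE scalerDr -addrA [t *: rho + _]addrC.
have {}KsumE : N%:R *: rho =
    G - t *: g 1 - \sum_(0 <= j < N) K (rad%:C * (z * w ^+ j)).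
  by rewrite KsumE opprB addrC subrK.
have NR0 : 0 < N%:R :> R by rewrite ltr0n.
have normN : normc N%:R = N%:R :> R.
  by rewrite -(rmorph_nat (real_complex R)) normc_real ger0_norm.
rewrite -(ler_pM2l NR0) -[in leLHS]normN -opnorm_scale KsumE.
have nl j : normc (l j) = rad.
  by rewrite /l /A !normcMr normcX z1 w1 expr1n !mulr1 normc_real gtr0_norm.
clearbody l; have rad10 : 0 < rad - 1 by rewrite subr_gt0.
have norm1 : normc 1 = 1 :> R.
  by rewrite -[1]/(1%:C) normc_real normr1.
have GN : opnorm G <= N%:R * (rad * M / (rad - 1) / rad ^+ k).
  rewrite (le_trans (opnorm_sum_le _ _ _))//.
  rewrite mulr_natl -[X in _ *+ X]subn0 -sumr_const_nat;
    apply: ler_sum_nat => j _.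
  have l1 : rad - 1 <= normc (l j - 1).
    rewrite lerBlDr -[in leLHS](nl j) -norm1.
    by rewrite (le_trans _ (normcD_le _ _))// subrK.
  have l1p := lt_le_trans rad10 l1.
  rewrite opnorm_scale /c !normcMr normcVr normcMr normcX nl.
  have -> : rad * M / (rad - 1) / rad ^+ k = rad / (rad ^+ k * (rad - 1)) * M.
    by rewrite invfM; ring.
  rewrite ler_pM ?opnorm_ge0 ?gM ?nl// ?mulr_ge0 ?invr_ge0 ?mulr_ge0 ?exprn_ge0
    ?normc_ge0// ?(ltW rad0)//.
  rewrite ler_pM2l// lef_pV2 ?posrE ?mulr_gt0 ?exprn_gt0//.
  by rewrite ler_pM2l ?exprn_gt0.
have tgN : opnorm (t *: g 1) <= N%:R * (M / (rad - 1) / n.+1%:R).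
  rewrite opnorm_scale /t normcMr normcVr normAN1 normN -mulrA ler_pM2l//.
  rewrite mulrC -mulrA -invfM ler_pM ?opnorm_ge0 ?gM ?norm1 ?(ltW rad1)//.
    by rewrite invr_ge0 addr_ge0// exprn_ge0// ltW.
  have q0 : 0 < rad ^+ N + 1 by rewrite addr_gt0 ?exprn_gt0.
  rewrite lef_pV2 ?posrE ?mulr_gt0//.
  rewrite (le_trans _ (_ : rad ^+ N <= _)) ?lerDl//.
  by rewrite (le_trans _ (natr_le_expr N rad1))// mulrC ler_pM2r// ler_nat ltnW.
rewrite (le_trans (opnormB_le _ _))//.
rewrite (le_trans (lerD (opnormB_le _ _) KN))//
  (le_trans (lerD (lerD GN tgN) (lexx _)))//.
rewrite -!mulrDr ler_pM2l// -addrA lerD2l [leRHS]mulrDl lerD2l.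
by rewrite ler_wpM2l// mulr_ge0 ?exprn_ge0 ?(ltW rad0)//
  mulr_ge0 ?addr_ge0 ?(ltW rad0).
Qed.

End CauchyEstimate.

                                                     

(** * Compactness and uniform neighborhoods *)

Section ComplexDisc.
Context {R : realType}.

Lemma normc_le_parts (s t : R) : normc (Complex s t) <= `|s| + `|t|.
Proof.
have -> : Complex s t = s%:C + Complex 0 t.
  by apply/eqP; rewrite eq_complex /= addr0 add0r !eqxx.
rewrite (le_trans (normcD_le _ _))// normc_real lerD2l /=.
by rewrite expr0n add0r sqrtr_sqr.
Qed.

(** Discs are taken in [R * R], where their compactness reduces to that of segments. *)
Definition cplx (p : R * R) : R[i] := Complex p.1 p.2.

Lemma cplxK (z : R[i]) : cplx (complex.Re z, complex.Im z) = z.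
Proof. by case: z. Qed.

Lemma near_cplx (p : R * R) (e : R) :
  0 < e -> \forall q \near p, normc (cplx p - cplx q) < e.
Proof.
case: p => s t e0; have e2 : 0 < e / 2 by rewrite divr_gt0.
exists (ball s (e / 2), ball t (e / 2)); first by split; exact: nbhsx_ballx.
move=> [s' t'] [/= ss' tt']; suff : normc (cplx (s, t) - cplx (s', t')) < e by
  [].
have -> : cplx (s, t) - cplx (s', t') = Complex (s - s') (t - t').
  by apply/eqP; rewrite eq_complex /= !eqxx.
rewrite (le_lt_trans (normc_le_parts _ _))//.
by rewrite [ltRHS]splitr ltrD// -ball_normE.
Qed.

Lemma compact_disc (r : R) : compact [set p : R * R | normc (cplx p) <= r].
Proof.
apply: (@subclosed_compact _ _ (`[- r, r] `*` `[- r, r])).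
- rewrite -openC openE => z /= /negP; rewrite -ltNge => rz.
  have e0 : 0 < normc (cplx z) - r by rewrite subr_gt0.
  have := near_cplx z e0; apply: filterS => z' zz'.
  suff rz' : r < normc (cplx z') by apply/negP; rewrite -ltNge.
  have := normcD_le (cplx z - cplx z') (cplx z'); rewrite subrK.
  move: zz'; lra.
- by apply: compact_setX; exact: segment_compact.
- move=> [s t] /= str.
  have sr : `|s| <= r.
    by rewrite (le_trans _ str)// -sqrtr_sqr ler_wsqrtr// lerDl sqr_ge0.
  have tr : `|t| <= r.
    by rewrite (le_trans _ str)// -sqrtr_sqr ler_wsqrtr// lerDr sqr_ge0.
  by split; rewrite /= in_itv /= -ler_norml.
Qed.

End ComplexDisc.

Section Neighborhoods.
Context {R : realType} {H : hilbertType R} {d : nat}.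
Implicit Types x y : 'rV[bop H]_d.

Definition close_tuples (e : R) x y := forall r, opnorm (x 0 r - y 0 r) < e.

Lemma nbhs_tupleP x (W : set 'rV[bop H]_d) :
  nbhs x W <-> exists2 e : R, 0 < e & forall y, close_tuples e x y -> W y.
Proof.
rewrite nbhs_ballP; split=> [[_ /= /lt0_complex[e e0 ->] eW]|[e e0 eW]].
  exists e => // y xy; apply: eW; split; first by rewrite ltcR.
  by move=> i j; rewrite ord1; apply/ball_opnorm.
exists e%:C; first by rewrite /= ltcR.
by move=> y [_ xy]; apply: eW => r; apply/ball_opnorm.
Qed.

Lemma bounded_nearP (T : Type) (f : T -> bop H) (G : set_system T) :
  Filter G ->
  bounded_near f G <-> exists M, G [set t | opnorm (f t) <= M].
Proof.
move=> FG; split.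
  move=> [M [Mr /(_ (M + 1))]] MG.
  exists (complex.Re (M + 1)); apply: filterS (MG _) => [t|];
    last by rewrite ltrDl.
  by move=> /= ft; rewrite opnorm_normle RRe_real// realD ?real1.
move=> [M MG]; exists M%:C; split; first by rewrite complex_real.
move=> r Mr; apply: filterS MG => t /= ft; apply: le_trans (ltW Mr).
by rewrite -opnorm_normle.
Qed.

Lemma locally_boundedP (Omega : set 'rV[bop H]_d) (F : 'rV[bop H]_d -> bop H) :
  [locally [bounded F x | x in Omega]] <->
  forall x, Omega x -> exists e M : R, 0 < e /\
    forall y, Omega y -> close_tuples e x y -> opnorm (F y) <= M.
Proof.
split=> lb x Ox.
  have /bounded_nearP[M /nbhs_tupleP[e e0 eM]] := lb x Ox.
  by exists e, M; split=> // y Oy xy; exact: eM.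
apply/bounded_nearP; have [e [M [e0 eM]]] := lb x Ox.
by exists M; apply/nbhs_tupleP; exists e => // y xy Oy; exact: eM.
Qed.

(** A tube lemma: a single integer [n] governs both the radius [1 / n.+1] and the bound [n], so
    compactness provides one value valid for all [s]. *)
Lemma compact_uniform_bound (T : topologicalType) (K : set T)
    (phi : T -> 'rV[bop H]_d) (B Omega : set 'rV[bop H]_d)
    (F : 'rV[bop H]_d -> bop H) :
    compact K ->
    (exists2 O : set 'rV[bop H]_d, open O & Omega = O `&` B) ->
    [locally [bounded F x | x in Omega]] ->
    (forall s, K s -> Omega (phi s)) ->
    (forall s e, K s -> 0 < e -> \forall t \near s, close_tuples e (phi s) (phi
      t)) ->
  exists e M : R, 0 < e /\ forall s y, K s -> B y ->
    close_tuples e (phi s) y -> Omega y /\ opnorm (F y) <= M.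
Proof.
move=> /compact_near_coveringP Kc [O Oo OE] /locally_boundedP lb KO phic.
pose P (n : nat) s := forall y, B y -> close_tuples (n.+1%:R^-1) (phi s) y ->
  Omega y /\ opnorm (F y) <= n%:R.
have [|N _ /(_ N (leqnn N)) NP] := Kc nat \oo P _; last first.
  exists (N.+1%:R^-1), N%:R; split=> [|s y Ks By sy]; first by rewrite invr_gt0.
  exact: (NP s Ks y By sy).
move=> s Ks; have Os := KO _ Ks.
have [e1 e10 e1O] : exists2 e, 0 < e & forall y, close_tuples e (phi s) y ->
  O y.
  by apply/nbhs_tupleP; apply: open_nbhs_nbhs; split=> //; move: Os;
    rewrite OE => -[].
have [e2 [M [e20 e2M]]] := lb _ Os.
(* One half of the radius pays for the move from [s] to [t], the other half for the move to [y]. *)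
pose e := Num.min e1 e2 / 2; have e0 : 0 < e by rewrite divr_gt0// lt_min e10.
pose n0 := maxn (Num.truncn e^-1) (Num.truncn M).+1.
exists ([set t | close_tuples e (phi s) (phi t)], [set n | (n0 <= n)%N]).
  split; first exact: phic.
  by exists n0.
move=> [t n] [/= st n0n] y By ty.
have sy : close_tuples (Num.min e1 e2) (phi s) y.
  move=> r; rewrite -(subrK (phi t 0 r) (phi s 0 r)) -addrA.
  rewrite (le_lt_trans (opnormD_le _ _))// [ltRHS]splitr ltrD ?st//.
  rewrite (lt_trans (ty r))// invf_plt ?posrE//.
  by rewrite (lt_le_trans (truncnS_gt _))// ler_nat ltnS (leq_trans _ n0n)//
    leq_maxl.
have Oy : Omega y.
  rewrite OE; split=> //; apply: e1O => r; rewrite (lt_le_trans (sy r))//.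
  by rewrite ge_min lexx.
split=> //; rewrite (le_trans (e2M y Oy _))//.
  by move=> r; rewrite (lt_le_trans (sy r))// ge_min lexx orbT.
rewrite (le_trans (ltW (truncnS_gt M)))// ler_nat (leq_trans _ n0n)//.
by rewrite leq_maxr.
Qed.

End Neighborhoods.

(** * Evaluation of free polynomials *)

Section PolynomialEvaluation.
Context {R : realType} {H : hilbertType R} {d : nat}.
Implicit Types (p q : free_poly R d) (x y : 'rV[bop H]_d).

Lemma pevalEw (D : {fset fmonom 'I_d}) p x : (msupp p `<=` D)%fset ->
  peval p x = \sum_(w <- D) mcoeff w p *: word_eval x w.
Proof.
move=> pD; rewrite /peval (big_fset_incl _ pD)// => w _ wp.
by rewrite mcoeff_outdom// scale0r.
Qed.

Lemma peval0 x : peval (0 : free_poly R d) x = 0.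
Proof. by rewrite /peval msupp0 big_seq_fset0. Qed.

Lemma pevalD p q x : peval (p + q) x = peval p x + peval q x.
Proof.
rewrite (pevalEw _ (msuppD_le p q)) (pevalEw (D :=
  (msupp p `|` msupp q)%fset) (p := p)) ?fsubsetUl//.
rewrite (pevalEw (D := (msupp p `|` msupp q)%fset) (p :=
  q)) ?fsubsetUr// -big_split /=.
by apply: eq_bigr => w _; rewrite mcoeffD scalerDl.
Qed.

Lemma peval_sum I (s : seq I) (P : pred I) (p : I -> free_poly R d) x :
  peval (\sum_(i <- s | P i) p i) x = \sum_(i <- s | P i) peval (p i) x.
Proof.
by elim/big_rec2: _ => [|i y q _ <-]; [exact: peval0|exact: pevalD].
Qed.

Lemma pevalU (w : fmonom 'I_d) c x : peval (mkmalgU w c) x = c *: word_eval x w.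
Proof.
by rewrite (pevalEw _ msuppU_le) big_seq_fset1 mcoeffUU.
Qed.

Lemma homogeneousD k p q : homogeneous_poly k p -> homogeneous_poly k q ->
  homogeneous_poly k (p + q).
Proof.
move=> pk qk w /(fsubsetP (msuppD_le p q)); rewrite inE => /orP[/pk|/qk] //.
Qed.

Lemma homogeneous0 k : homogeneous_poly k (0 : free_poly R d).
Proof. by move=> w; rewrite msupp0. Qed.

Lemma homogeneousU (w : fmonom 'I_d) c :
  homogeneous_poly (fdeg w) (mkmalgU w c : free_poly R d).
Proof. by move=> v /(fsubsetP msuppU_le); rewrite inE => /eqP ->. Qed.

Lemma peval_intertwining p x y (L : bop H) :
  (forall r, L * x 0 r = y 0 r * L) -> L * peval p x = peval p y * L.
Proof.
move=> Lxy; rewrite /peval mulr_sumr mulr_suml; apply: eq_bigr => w _.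
rewrite mulbZr mulbZl; congr (_ *: _); elim: (w : seq 'I_d) => [|r v ih].
  by rewrite !big_nil mulr1 mul1r.
by rewrite !big_cons mulrA Lxy -mulrA ih mulrA.
Qed.

Lemma peval_bounded p (C : R) : exists M, forall x,
  (forall r, opnorm (x 0 r) <= C) -> opnorm (peval p x) <= M.
Proof.
exists (\sum_(w <- msupp p) normc (mcoeff w p) * `|C| ^+ size (w :
  seq 'I_d)) => x xC.
rewrite (le_trans (opnorm_sum_le _ _ _))//; apply: ler_sum => w _.
rewrite opnorm_scale ler_wpM2l ?normc_ge0//.
by apply: opnorm_prod_le => // r; rewrite (le_trans (xC r))// ler_norm.
Qed.

End PolynomialEvaluation.

                                           

(** * Taylor polynomials of an intertwining preserving function *)

Section HomogeneousParts.
Context {R : realType} {H : hilbertType R} {A : set (bop H)} {d : nat}.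
Context {U : forall n, unitary H n.+1} {Omega : set 'rV[bop H]_d}.
Context {F : 'rV[bop H]_d -> bop H}.
Hypotheses (A_algebra : unital_subalgebra A) (A_dsum : direct_sum_property A U).
Hypotheses (Omega_nc : nc_domain A U Omega) (Omega_balanced : balanced Omega).
Hypothesis F_intertwining : intertwining_preserving Omega F.

(** Balance with the factor 0 puts the zero tuple in [Omega], which is relatively open. *)
Lemma small_tuples_mem x0 : Omega x0 -> exists2 e : R, 0 < e & forall y,
  tuples_in A y -> (forall r, opnorm (y 0 r) < e) -> Omega y.
Proof.
move=> Ox0; have O0 : Omega (\row_r (0 *: x0 0 r)).
  by apply: Omega_balanced => //; rewrite normr0.
have [O Oo OE] := nc_domain_open Omega_nc.
have [e e0 eO] : exists2 e, 0 < e & forall y, close_tuples e (\row_r (0 *: x0 0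
  r)) y -> O y.
  by apply/nbhs_tupleP; apply: open_nbhs_nbhs; split=> //; move: O0;
    rewrite OE => -[].
exists e => // y Ay ye; rewrite OE; split=> //; apply: eO => r.
by rewrite mxE scale0r sub0r opnormN.
Qed.

Lemma creation_mem x0 N (W : 'I_N.+1 -> seq 'I_d) : Omega x0 ->
  (forall i j, (size (W j) < size (W i))%N -> (i < j)%N) ->
  exists2 t : R[i], t != 0 & Omega (creation (U N) W t).
Proof.
move=> /small_tuples_mem[e e0 eO] Wlt.
(* The denominator exceeds the number of blocks, each of norm at most [t], so their norms add up to
   less than [e]. *)
pose t : R := e / (N.+1 * N.+1).+1%:R; have t0 : 0 < t by rewrite divr_gt0.
exists t%:C; first by rewrite -normc_eq0 normc_real normr_eq0 gt_eqF.
have [A1 _ AZ _] := A_algebra.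
apply: eO => r; rewrite mxE.
  apply: A_dsum => i j; first by rewrite mxE; exact: AZ.
  rewrite mxE; case: eqP => [Wij ji|_ _]; last by rewrite scale0r.
  have : (i < j)%N by apply: Wlt; rewrite Wij.
  by rewrite ltnNge (ltnW ji).
rewrite (le_lt_trans (opnorm_opconj_le _ _))//.
apply: (@le_lt_trans _ _ (\sum_(i < N.+1) \sum_(j < N.+1) t)).
  apply: ler_sum => i _; apply: ler_sum => j _; rewrite mxE opnorm_scale.
  rewrite -[leRHS]mulr1 ler_pM ?normc_ge0 ?opnorm_ge0//.
    case: ifP => _; first by rewrite normc_real gtr0_norm.
    by rewrite (eqP (_ : normc 0 == 0)) ?normc_eq0 ?ltW.
  by apply: opnorm_le => // x; rewrite rmorph1 mul1r.
rewrite !sumr_const !card_ord -mulrnA -[t *+ _]mulr_natr /t mulrAC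
  ltr_pdivrMr//.
by rewrite ltr_pM2l// ltr_nat.
Qed.

                                                                                
                                                            
(** The coefficient of a word of length [m] is [t ^- m] times the scalar block of [F (creation t)]
    in the row of that word and the column of the empty word. It is fixed before [n], [T], [x] and
    [e] are chosen. *)
Lemma homogeneous_part x0 m : Omega x0 -> exists2 p : free_poly R d,
  homogeneous_poly m p &
  forall n (T : 'M[R[i]]_n.+1) x (e : R[i]), (m <= n)%N ->
    (forall i j : 'I_n.+1, (j <= m)%N -> T i j = if i.+1 == j then e else 0) ->
    Omega (tensor (U n) T x) ->
    coord_out (U n) ord0 * F (tensor (U n) T x) * coord_in (U n) (inord m) =
      e ^+ m *: peval p x.
Proof.
move=> Ox0; have [N [W [W_inj W_le W_onto W_lt]]] := words_enumeration d m.
have [t t0 Ot] := creation_mem Ox0 W_lt.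
have [i0 Wi0] := W_onto [::] (leq0n m).
have /choice[c cE] : forall i, exists c : R[i], coord_out (U N) i *
    F (creation (U N) W t) * coord_in (U N) i0 = c *: (1 : bop H).
  by move=> i; apply: (creation_compression F_intertwining).
exists (\sum_(i | size (W i) == m) mkmalgU (FMonom (W i)) (t ^- m * c i)).
  elim/big_rec: _ => [|i q /eqP Wi ih]; first exact: homogeneous0.
  by apply: homogeneousD => //; rewrite -Wi; exact: homogeneousU.
move=> n T x e mn TE OX; rewrite (tensor_creation _ W_inj W_le W_onto mn TE t0
  Wi0 cE Ot OX)//.
by congr (_ *: _); rewrite peval_sum; apply: eq_bigr => i _; rewrite pevalU.
Qed.

End HomogeneousParts.

(** * Divided differences and the remainder of the series *)

Section NewtonInterpolation.
Context {R : realType}.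

                                                                            
                                                      
Definition jordan n (e : R[i]) (t : nat -> R[i]) : 'M[R[i]]_n :=
  \matrix_(i, j) (if i == j then t i else if i.+1 == j then e else 0).

Definition newton_weight (e : R[i]) (t : nat -> R[i]) (l : R[i]) (j : nat) :=
  e ^- j * \prod_(i < j) (l - t i).

(** Each row amounts to the recurrence [e v_(i+1) = (l - t i) v_i] for the weights; the last row
    closes because the product over all nodes vanishes. *)
Lemma jordan_eigenvector n (e : R[i]) (t : nat -> R[i]) (l : R[i]) : e != 0 ->
  \prod_(i < n) (l - t i) = 0 ->
  forall i : 'I_n, \sum_j jordan n e t i j * newton_weight e t l j =
    l * newton_weight e t l i.
Proof.
move=> e0 prod0 i.
have vS : e * newton_weight e t l i.+1 = (l - t i) * newton_weight e t l i.
  by rewrite /newton_weight big_ord_recr /= exprS; field; rewrite e0 expf_neq0.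
rewrite (bigD1 i)//= mxE eqxx.
apply/eqP; rewrite addrC -subr_eq0 -addrA -opprB subr_eq0 -mulrBl -vS;
  apply/eqP.
have := ltn_ord i; rewrite leq_eqVlt => /orP[/eqP iN|iN].
  rewrite iN /newton_weight prod0 !mulr0 big1// => j /negPf ji.
  by rewrite mxE eq_sym ji iN eq_sym (ltn_eqF (ltn_ord j)) mul0r.
rewrite (bigD1 (Ordinal iN)) /=; last by rewrite -val_eqE /= gtn_eqF.
rewrite mxE -val_eqE /= (ltn_eqF (ltnSn i)) eqxx big1 ?addr0// =>
  j /andP[ji jS].
rewrite mxE eq_sym (negPf ji) ifN ?mul0r// eq_sym.
by move: jS; rewrite -val_eqE.
Qed.

End NewtonInterpolation.

Section Remainder.
Context {R : realType} {H : hilbertType R}.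

Lemma opconj_close n (U : unitary H n) (S T : 'M[bop H]_n) (c : R) :
  (forall i j, opnorm (S i j - T i j) <= c) ->
  opnorm (opconj U S - opconj U T) <= (n * n)%:R * c.
Proof.
move=> STc; rewrite opconjB (le_trans (opnorm_opconj_le _ _))//.
apply: (@le_trans _ _ (\sum_(i < n) \sum_(j < n) c)).
  by apply: ler_sum => i _; apply: ler_sum => j _; rewrite mxE.
by rewrite !sumr_const !card_ord -mulrnA mulr_natl.
Qed.

Lemma small_factor (n : nat) (B e : R) : 0 <= B -> 0 < e ->
  exists2 u, 0 < u & n%:R * (u * B) < e.
Proof.
move=> B0 e0; have q0 : 0 < n%:R * B + 1 by rewrite ltr_wpDl// mulr_ge0.
exists (e / (n%:R * B + 1)); first by rewrite divr_gt0.
rewrite mulrC mulrAC mulrAC -mulrA mulrAC ltr_pdivrMr//.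
by rewrite ltr_pM2l// [B * _]mulrC ltrDl.
Qed.

Context {A : set (bop H)} {d : nat}.
Context {U : forall n, unitary H n.+1} {Omega : set 'rV[bop H]_d}.
Context {F : 'rV[bop H]_d -> bop H}.
Hypotheses (A_algebra : unital_subalgebra A) (A_dsum : direct_sum_property A U).
Hypotheses (Omega_nc : nc_domain A U Omega) (Omega_balanced : balanced Omega).
Hypothesis F_nc : nc_function Omega F.

Definition tuple_norm (x : 'rV[bop H]_d) : R := \sum_r opnorm (x 0 r).

Lemma tuple_norm_ge0 x : 0 <= tuple_norm x.
Proof. by apply: sumr_ge0 => r _; exact: opnorm_ge0. Qed.

Lemma tuple_norm_ge (x : 'rV[bop H]_d) r : opnorm (x 0 r) <= tuple_norm x.
Proof. by rewrite /tuple_norm (bigD1 r)//= lerDl sumr_ge0// => s _;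
  exact: opnorm_ge0. Qed.

(** By balance the compact disc of multiples of [x] lies in [Omega], so it has a uniform
    neighborhood there on which [F] is bounded. This leaves room to enlarge the radius beyond 1 and
    to replace [x] by [y]. *)
Lemma dilated_disc x : Omega x -> exists e rad M : R, [/\ 0 < e, 1 < rad &
  forall y l, Omega y -> close_tuples e x y -> normc l <= rad ->
    Omega (scale_tuple l y) /\ opnorm (F (scale_tuple l y)) <= M].
Proof.
move=> Ox; have [_ _ AZ _] := A_algebra.
have [||e [M [e0 eM]]] := compact_uniform_bound (phi := fun p =>
  scale_tuple (cplx p) x)
  (@compact_disc R 1) (nc_domain_open Omega_nc) F_nc.1.
- move=> p p1; apply: Omega_balanced => //.
  by have : normc (cplx p) <= 1 := p1; rewrite normc_le.
- move=> s e _ e0; have [u u0] := small_factor 1 (tuple_norm_ge0 x) e0.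
  rewrite mul1r => ue; apply: filterS (near_cplx s u0) => t st r.
  rewrite !mxE -scalerBl opnorm_scale (le_lt_trans _ ue)//.
  by rewrite ler_pM ?normc_ge0 ?opnorm_ge0 ?tuple_norm_ge// ltW.
have e2 : 0 < e / 2 by rewrite divr_gt0.
have [u u0] := small_factor 1 (tuple_norm_ge0 x) e2; rewrite mul1r => ue.
have rad0 : 0 < 1 + u by rewrite addr_gt0.
exists (e / 2 / (1 + u)), (1 + u), M; split=> [||y l Oy xy lu].
- by rewrite divr_gt0.
- by rewrite ltrDl.
(* [mu] is [l] brought back to the unit disc; [l y] is compared with [mu x]. *)
pose mu := l / (1 + u)%:C.
have nmu : normc mu <= 1.
  by rewrite /mu normcMr normcVr normc_real gtr0_norm// ler_pdivrMr// mul1r.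
apply: (eM (complex.Re mu, complex.Im mu)); rewrite ?cplxK//.
  by have := nmu; rewrite -{1}(cplxK mu).
  by move=> r; rewrite mxE; apply: AZ; exact: (nc_domain_sub Omega_nc Oy).
move=> r; rewrite !mxE.
have lE : l = mu * (1 + u)%:C.
  by rewrite /mu divfK// -normc_eq0 normc_real normr_eq0 gt_eqF.
have -> : mu *: x 0 r - l *: y 0 r = mu *: (x 0 r - (1 + u)%:C *: y 0 r).
  by rewrite scalerBr scalerA -lE.
rewrite opnorm_scale.
rewrite (le_lt_trans (ler_wpM2r (opnorm_ge0 _) nmu))// mul1r.
have -> : x 0 r - (1 + u)%:C *: y 0 r =
  (1 + u)%:C *: (x 0 r - y 0 r) - u%:C *: x 0 r.
  by rewrite scalerBr addrAC -scalerBl -rmorphB addrK scale1r.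
rewrite (le_lt_trans (opnormB_le _ _))//
  [ltRHS]splitr !opnorm_scale !normc_real.
rewrite gtr0_norm// gtr0_norm// ltrD//.
  by rewrite mulrC -ltr_pdivlMr.
by rewrite (le_lt_trans _ ue)// ler_pM2l// tuple_norm_ge.
Qed.

Section Estimate.
Context (p : nat -> free_poly R d) (x : 'rV[bop H]_d) (rad M : R).
Hypothesis pE : forall m n (T : 'M[R[i]]_n.+1) y (e : R[i]), (m <= n)%N ->
    (forall i j : 'I_n.+1, (j <= m)%N -> T i j = if i.+1 == j then e else 0) ->
    Omega (tensor (U n) T y) ->
    coord_out (U n) ord0 * F (tensor (U n) T y) * coord_in (U n) (inord m) =
      e ^+ m *: peval (p m) y.
Hypotheses (Ox : Omega x) (rad1 : 1 < rad).
Hypothesis xM : forall l, normc l <= rad ->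
  Omega (scale_tuple l x) /\ opnorm (F (scale_tuple l x)) <= M.

(** The [k] zeros produce the Taylor terms, the node 1 the remainder at [x], and the free nodes [a],
    [b], [c] the divided differences to be bounded. *)
Definition nodes (k : nat) (a b c : R[i]) (i : nat) : R[i] :=
  if (i < k)%N then 0 else nth 0 [:: 1; a; b; c] (i - k).

Lemma nodes_le k a b c i : normc a <= rad -> normc b <= rad -> normc c <= rad ->
  normc (nodes k a b c i) <= rad.
Proof.
move=> aR bR cR; rewrite /nodes.
have n0 : normc 0 <= rad.
  by rewrite (eqP (_ : normc 0 == 0)) ?normc_eq0 ?(ltW (lt_trans _ rad1)).
have n1 : normc 1 <= rad by rewrite -[1]/(1%:C) normc_real normr1 ltW.
by case: ifP => // _; case: (i - k)%N => [|[|[|[|n]]]] //; rewrite /= nth_nil.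
Qed.

Lemma nodes_dist k a b c a' b' c' (u : R) i : 0 <= u -> normc (a - a') <= u ->
  normc (b - b') <= u -> normc (c - c') <= u ->
  normc (nodes k a b c i - nodes k a' b' c' i) <= u.
Proof.
move=> u0 aR bR cR; rewrite /nodes.
have n0 (z : R[i]) : normc (z - z) <= u.
  by rewrite subrr (eqP (_ : normc 0 == 0)) ?normc_eq0.
by case: ifP => // _; case: (i - k)%N => [|[|[|[|n]]]] //; rewrite /= nth_nil.
Qed.

(** Without superdiagonal the tuple is a direct sum of multiples of [x], hence in [Omega], and it
    depends continuously on [a], [b], [c] in a compact disc. A small superdiagonal [e] keeps it
    upper triangular over [A] and within the uniform neighborhood of that compact family. *)
Lemma jordan_domain k : exists e C : R, 0 < e /\ forall a b c,
  normc a <= rad -> normc b <= rad -> normc c <= rad ->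
  let X := tensor (U k.+3) (jordan k.+4 e%:C (nodes k a b c)) x in
  Omega X /\ opnorm (F X) <= C.
Proof.
pose D := [set q : R * R | normc (cplx q) <= rad].
pose t (s : R * R * (R * R) * (R * R)) :=
  nodes k (cplx s.1.1) (cplx s.1.2) (cplx s.2).
pose phi s := conj_dsum (U k.+3) (fun i => scale_tuple (t s i) x).
have D1 : compact D := @compact_disc R rad.
have Dc : compact (D `*` D `*` D) := compact_setX (compact_setX D1 D1) D1.
have [||e [C [e0 eC]]] := compact_uniform_bound (phi := phi) Dc
    (nc_domain_open Omega_nc) F_nc.1.
- move=> s [[sa sb] sc]; apply: (nc_domain_dsum Omega_nc (n := k.+2)) => i.
  by have [] := xM (nodes_le k i sa sb sc).
- move=> [[s1 s2] s3] e _ e0.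
  have [u u0 ue] := small_factor (k.+4 * k.+4) (tuple_norm_ge0 x) e0.
  pose B s : set (R * R) := [set q | normc (cplx s - cplx q) < u].
  exists (B s1 `*` B s2, B s3).
    split; last exact: near_cplx.
    by exists (B s1, B s2) => //; split; exact: near_cplx.
  move=> q [[/ltW qa /ltW qb] /ltW qc] r.
  rewrite !mxE (le_lt_trans (opconj_close _ _) ue)// => i j; rewrite !mxE.
  case: (i == j); last by rewrite subrr opnorm0 mulr_ge0 ?tuple_norm_ge0// ltW.
  rewrite !mulr1n -scalerBl opnorm_scale.
  by rewrite ler_pM ?normc_ge0 ?opnorm_ge0 ?tuple_norm_ge ?nodes_dist// ltW.
have [u u0 ue] := small_factor (k.+4 * k.+4) (tuple_norm_ge0 x) e0.
exists u, C; split=> // a b c aR bR cR /=.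
have [_ _ AZ _] := A_algebra.
pose s := ((complex.Re a, complex.Im a), (complex.Re b, complex.Im b),
  (complex.Re c, complex.Im c)).
have ts : t s = nodes k a b c.
  by rewrite /t !cplxK.
apply: (eC s).
- have Dz z : normc z <= rad -> D (complex.Re z, complex.Im z).
    by rewrite -{1}(cplxK z).
  by split; [split|]; exact: Dz.
- move=> r; rewrite mxE; apply: A_dsum => i j; rewrite mxE.
    by apply: AZ; exact: (nc_domain_sub Omega_nc Ox).
  move=> ji; rewrite mxE ifN ?ifN ?scale0r//; apply/eqP.
    by move=> ij; move: ji; rewrite -ij ltnNge leqnSn.
  by move=> ij; move: ji; rewrite ij ltnn.
move=> r; rewrite !mxE (le_lt_trans (opconj_close _ _) ue)// => i j;
  rewrite !mxE.
rewrite ts; case: (i == j); first by rewrite subrr opnorm0 mulr_ge0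
  ?tuple_norm_ge0// ltW.
rewrite mulr0n sub0r opnormN opnorm_scale; case: ifP => _.
  by rewrite normc_real gtr0_norm// ler_wpM2l ?tuple_norm_ge// ltW.
rewrite (eqP (_ : normc 0 == 0)) ?normc_eq0// mul0r mulr_ge0 ?tuple_norm_ge0//.
exact: ltW.
Qed.

(** Newton interpolation of [l |-> F (l x)] at the nodes supplies the hypothesis of
    [cauchy_remainder], with a constant that may depend on [x] and [k]; the final bound involves
    only [rad], [M] and [k]. *)
Lemma series_remainder k :
  opnorm (F x - \sum_(m < k) peval (p m) x) <= rad * M / (rad - 1) / rad ^+ k.
Proof.
have x1 : scale_tuple 1 x = x by apply/rowP => r; rewrite mxE scale1r.
rewrite -[in F x]x1.
have [e [C [e0 eC]]] := jordan_domain k.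
have e0C : e%:C != 0 by rewrite -normc_eq0 normc_real normr_eq0 gt_eqF.
apply: (@cauchy_remainder _ _ (fun l => F (scale_tuple l x)) (fun m =>
  peval (p m) x) k rad M
  (\sum_(j < k.+4) e ^- j * C) rad1) => [l /xM[]//|a b c aR bR cR].
have /= [OX XC] := eC a b c aR bR cR.
set X := tensor _ _ _ in OX XC.
(* The divided differences: first-row blocks freed of the powers of [e] carried by the
   eigenvectors. *)
pose f (j : nat) := (e%:C ^- j) *: (coord_out (U k.+3) ord0 * F X * coord_in (U
  k.+3) (inord j)).
have fC j : (j < k.+4)%N -> opnorm (f j) <= \sum_(j < k.+4) e ^- j * C.
  move=> jk; rewrite (bigD1 (Ordinal jk))//= -[leLHS]addr0 lerD//.
    rewrite opnorm_scale normcVr normcX normc_real gtr0_norm//.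
    rewrite ler_wpM2l ?invr_ge0 ?exprn_ge0 ?(ltW e0)//.
    by rewrite (le_trans (opnorm_compression _ _ _ _)).
  apply: sumr_ge0 => i _; rewrite mulr_ge0 ?invr_ge0 ?exprn_ge0 ?(ltW e0)//.
  by rewrite (le_trans _ XC) ?opnorm_ge0.
have fE m : (m < k)%N -> f m = peval (p m) x.
  move=> mk; rewrite /f (pE (e := e%:C) _ _ OX); first last.
  - move=> i j jm; rewrite mxE; case: eqP => [->|//].
    by rewrite /nodes (leq_ltn_trans jm mk) gtn_eqF.
  - by lia.
  by rewrite scalerA mulVf ?expf_neq0// scale1r.
have prodE l j : (j <= k)%N -> \prod_(i < j) (l - nodes k a b c i) = l ^+ j.
  move=> jk; rewrite -[X in l ^+ X]card_ord -prodr_const; apply: eq_bigr => i _.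
  by rewrite /nodes (leq_trans (ltn_ord i) jk) subr0.
have newton l : l \in [:: 1; a; b; c] -> F (scale_tuple l x) =
    \sum_(m < k) l ^+ m *: peval (p m) x + l ^+ k *: f k + (l ^+ k * (l - 1)) *:
      (f k.+1 + (l - a) *: f k.+2 + ((l - a) * (l - b)) *: f k.+3).
  move=> labc; have lR : normc l <= rad.
    move: labc; rewrite !inE => /or4P[] /eqP -> //.
    by rewrite -[1]/(1%:C) normc_real normr1 ltW.
  have nodek i : nodes k a b c (k + i) = nth 0 [:: 1; a; b; c] i.
    by rewrite /nodes ltnNge leq_addr /= addKn.
  have prod0 : \prod_(i < k.+4) (l - nodes k a b c i) = 0.
    pose q := index l [:: 1; a; b; c].
    have qk : (k + q < k.+4)%N by rewrite -[k.+4]addn4 ltn_add2l -index_mem in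
      labc *.
    by rewrite (bigD1 (Ordinal qk))//= nodek nth_index// subrr mul0r.
  have [Olx _] := xM lR.
  (* In row 0 the eigenvector has entry 1, so the left side is [F (l x)] itself. *)
  have := tensor_eigenvector F_nc.2 (jordan_eigenvector e0C prod0) OX Olx ord0.
  rewrite {1}/newton_weight expr0 invr1 big_ord0 mulr1 scale1r => ->.
  have -> : \sum_(j < k.+4) newton_weight e%:C (nodes k a b c) l j *:
      (coord_out (U k.+3) ord0 * F X * coord_in (U k.+3) j) =
      \sum_(j < k.+4) (\prod_(i < j) (l - nodes k a b c i)) *: f j.
    by apply: eq_bigr => j _; rewrite /f inord_val scalerA mulrC.
  rewrite !big_ord_recr /= prodE//.
  have nk0 : nodes k a b c k = 1 by have := nodek 0%N; rewrite addn0.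
  have nk1 : nodes k a b c k.+1 = a by have := nodek 1%N; rewrite addn1.
  have nk2 : nodes k a b c k.+2 = b by have := nodek 2%N; rewrite addn2.
  rewrite nk0 nk1 nk2 !scalerDr !scalerA !mulrA !addrA;
    congr (_ + _ + _ + _ + _).
  by apply: eq_bigr => j _; rewrite prodE 1?ltnW// fE.
(* At [l = 1] every Newton term beyond the [k]-th vanishes. *)
have fk : f k = F (scale_tuple 1 x) - \sum_(m < k) peval (p m) x.
  rewrite (newton 1) ?mem_head// subrr mulr0 scale0r addr0 expr1n scale1r.
  under eq_bigr do rewrite expr1n scale1r.
  by rewrite addrC addKr.
exists (f k.+1), (f k.+2), (f k.+3); split; try by apply: fC; lia.
move=> l labc; rewrite -fk; apply: newton.
by rewrite !inE; case: labc => ->; rewrite eqxx ?orbT.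
Qed.

End Estimate.
End Remainder.

(** * Convergence and the three implications *)

Section UniformConvergence.
Context {R : realType} {H : hilbertType R} {d : nat}.

Lemma uniform_cvgP (B : set 'rV[bop H]_d) (f : nat -> 'rV[bop H]_d -> bop H)
    (F : 'rV[bop H]_d -> bop H) :
  {uniform B, f @ \oo --> F} <-> forall e : R, 0 < e -> exists N, forall n y,
    (N <= n)%N -> B y -> opnorm (F y - f n y) < e.
Proof.
split=> [fF e e0|fF P /uniform_nbhs[E [+ EP]]].
  have [|N _ NP] := fF [set h | forall y, B y -> ball (F y) e%:C (h y)].
    apply/uniform_nbhs; exists [set p | ball p.1 e%:C p.2]; split=> //.
    by rewrite -entourage_ballE; exists e%:C => //=; rewrite ltcR.
  by exists N => n y Nn By; apply/ball_opnorm; exact: NP.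
rewrite -entourage_ballE => -[_ /= /lt0_complex[e e0 ->] eE].
have [N NP] := fF _ e0; exists N => // n Nn; apply: EP => y By.
by apply: eE; apply/ball_opnorm; exact: NP.
Qed.

Lemma cvg_normed_series (u : nat -> bop H) (B q : R) : 0 < q -> q < 1 ->
  (forall k, opnorm (u k) <= B * q ^+ k) -> cvgn [normed series u].
Proof.
move=> q0 q1 uB.
have : cvgn (series (fun k => opnorm (u k))).
  apply: (@series_le_cvg _ _ (geometric B q)) => [k|k|k|].
  - exact: opnorm_ge0.
  - by rewrite (le_trans _ (uB k))// opnorm_ge0.
  - exact: uB.
  - by apply: is_cvg_geometric_series; rewrite gtr0_norm.
move=> /cvg_ex[l /cvgrPdist_lt ul]; apply/cvg_ex; exists l%:C.
apply/cvgrPdist_lt => _ /lt0_complex[e e0 ->].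
apply: filterS (ul e e0) => n.
have -> : [normed series u] n = (series (fun k => opnorm (u k)) n)%:C.
  by rewrite /series /= rmorph_sum.
by rewrite -rmorphB -normcE normc_real ltcR.
Qed.

End UniformConvergence.

Theorem theorem4p3 (R : realType) (H : hilbertType R)
    (H_infinite : infinite_dimensional H)
    (A : set (bop H)) (A_algebra : unital_subalgebra A) (A_closed : closed A)
    (U : forall n, unitary H n.+1) (A_dsum : direct_sum_property A U)
    (d : nat) (d_gt0 : (0 < d)%N)
    (Omega : set 'rV[bop H]_d) (Omega_nc : nc_domain A U Omega)
    (Omega_balanced : balanced Omega) (F : 'rV[bop H]_d -> bop H) :
  [<->
    nc_function Omega F;
    exists2 p : nat -> free_poly R d,
      (forall k, homogeneous_poly k (p k)) &
      forall x, Omega x ->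
        cvgn [normed series (fun k => peval (p k) x)] /\
        uniform_cvg_near Omega
          (fun n y => series (fun k => peval (p k) y) n) F x;
    forall x y z, Omega x -> Omega y -> Omega z ->
      exists p : nat -> free_poly R d,
        [/\ uniform_cvg_near Omega (fun k => peval (p k)) F x,
            uniform_cvg_near Omega (fun k => peval (p k)) F y &
            uniform_cvg_near Omega (fun k => peval (p k)) F z]].
Proof.
tfae.
- move=> F_nc; have [[x0 Ox0]|O0] := pselect (exists x, Omega x); last first.
    (* An empty [Omega] offers no base point for the construction; the zero series will do. *)
    exists (fun=> 0) => [k|x Ox]; first exact: homogeneous0.
    by case: O0; exists x.
  have /choice[p pP] : forall m, exists p :
    free_poly R d, homogeneous_poly m p /\
      forall n (T : 'M[R[i]]_n.+1) y (e : R[i]), (m <= n)%N ->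
      (forall i j : 'I_n.+1, (j <= m)%N -> T i j =
        if i.+1 == j then e else 0) ->
      Omega (tensor (U n) T y) ->
      coord_out (U n) ord0 * F (tensor (U n) T y) * coord_in (U n) (inord m) =
      e ^+ m *: peval p y.
    move=> m; have [p ph pE] := homogeneous_part A_algebra A_dsum Omega_nc
      Omega_balanced F_nc.2 m Ox0.
    by exists p.
  exists p => [k|x Ox]; first by have [] := pP k.
  have [e [rad [M [e0 rad1 xM]]]] := dilated_disc A_algebra Omega_nc
    Omega_balanced F_nc Ox.
  pose B := rad * M / (rad - 1).
  have rem y k : Omega y -> close_tuples e x y ->
      opnorm (F y - \sum_(m < k) peval (p m) y) <= B / rad ^+ k.
    move=> Oy xy; apply: (series_remainder A_algebra A_dsum Omega_nc F_nc
      (fun m => (pP m).2) Oy rad1) => l lr.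
    exact: xM.
  have rad0 : 0 < rad by rewrite (lt_trans _ rad1).
  split.
    (* The term [p k] at [x] is the difference of two consecutive remainders, whence [2 * B]. *)
    apply: (@cvg_normed_series _ _ _ (2 * B) rad^-1).
    - by rewrite invr_gt0.
    - by rewrite invf_lt1.
    have xx : close_tuples e x x by move=> r; rewrite subrr opnorm0.
    move=> k; have := rem x k.+1 Ox xx; have := rem x k Ox xx.
    rewrite big_ord_recr /=; set S := \sum_(i < k) _ => Sk Sk1.
    have -> : peval (p k) x = (F x - S) - (F x - (S + peval (p k) x)).
      by rewrite opprB addrC addrA subrK [S + _]addrC addrK.
    rewrite (le_trans (opnormB_le _ _))// (le_trans (lerD Sk Sk1))//.
    have B0 : 0 <= B.
      by have := le_trans (opnorm_ge0 _) (rem x 0 Ox xx); rewrite expr0 divr1.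
    rewrite exprVn -mulrA mulr_natl mulr2n lerD2l ler_wpM2l//.
    by rewrite lef_pV2 ?posrE ?exprn_gt0// ler_weXn2l// ltW.
  exists [set y | close_tuples e x y].
    by apply/nbhs_tupleP; exists e.
  (* As [rad ^+ n >= n (rad - 1)], any [n > B / (r (rad - 1))] makes the remainder smaller than
     [r]. *)
  apply/uniform_cvgP => r r0; exists (Num.truncn (B / (r * (rad - 1)))).+1.
  move=> n y Nn [Oy xy]; rewrite /series /= big_mkord.
  have rad10 : 0 < rad - 1 by rewrite subr_gt0.
  rewrite (le_lt_trans (rem y n Oy xy))// ltr_pdivrMr ?exprn_gt0//.
  rewrite (lt_le_trans _ (ler_wpM2l (ltW r0) (natr_le_expr n rad1)))//.
  rewrite mulrCA -ltr_pdivrMr ?mulr_gt0//.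
  by rewrite (lt_le_trans (truncnS_gt _))// ler_nat.
- move=> [p ph pF] x y z Ox Oy Oz.
  exists (fun n => \sum_(0 <= k < n) p k).
  suff pE : (fun k => peval (\sum_(0 <= i < k) p i)) =
      (fun n (y : 'rV[bop H]_d) => series (fun k => peval (p k) y) n).
    by rewrite pE; split; [have [] := pF x Ox|have [] := pF y Oy|have [] :=
      pF z Oz].
  apply/funext => n; apply/funext => t.
  by rewrite /series /= peval_sum.
- move=> polys; split.
    apply/locally_boundedP => x Ox.
    have [p [+ _ _]] := polys x x x Ox Ox Ox.
    (* One polynomial within distance 1 of [F] near [x] suffices, since it is bounded on the bounded
       set [Omega]. *)
    move=> [W /nbhs_tupleP[e e0 eW] /uniform_cvgP/(_ 1 ltr01)[N NP]].
    have /choice[C CP] : forall r, exists C, forall y, Omega y ->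
      opnorm (y 0 r) <= C.
      move=> r; have [M [Mr MP]] := nc_domain_bounded Omega_nc r.
      exists (complex.Re (M + 1)) => y Oy.
      rewrite opnorm_normle RRe_real ?realD ?real1//.
      by apply: (MP (M + 1) _ y Oy); rewrite ltrDl.
    have [M MP] := @peval_bounded _ H _ (p N) (\sum_r `|C r|).
    exists e, (1 + M); split=> // y Oy /eW Wy.
    rewrite -[F y](subrK (peval (p N) y)) (le_trans (opnormD_le _ _))// lerD//.
      by rewrite ltW// NP.
    apply: MP => r; rewrite (le_trans (CP r y Oy))// (bigD1 r)//=.
    by rewrite (le_trans (ler_norm _))// lerDl sumr_ge0.
  move=> x y L Ox Oy Lxy.
  have [p [[Wx xW px] [Wy yW py] _]] := polys x y y Ox Oy Oy.
  apply/eqP; rewrite -subr_eq0; apply/eqP/opnorm_eq0.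
  suff -> : opnorm (L * F x - F y * L) = 0 by [].
  apply/eqP; rewrite eq_le opnorm_ge0 andbT; apply/ler_addgt0Pr => e e0.
  have [u u0 ue] := small_factor 2 (opnorm_ge0 L) e0.
  move: px py => /uniform_cvgP/(_ u u0)[N1 N1P] /uniform_cvgP/(_ u u0)[N2 N2P].
  (* The same polynomial must be close to [F] at both [x] and [y], so that its own intertwining
     relation can be subtracted. *)
  pose q := p (maxn N1 N2).
  have qx : opnorm (F x - peval q x) < u.
    by apply: N1P; [exact: leq_maxl|split=> //; exact: nbhs_singleton].
  have qy : opnorm (F y - peval q y) < u.
    by apply: N2P; [exact: leq_maxr|split=> //; exact: nbhs_singleton].
  have -> : L * F x - F y * L = L * (F x - peval q x) - (F y - peval q y) * L.
    by rewrite mulrBr mulrBl (peval_intertwining q Lxy) opprB addrA subrK.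
  rewrite add0r (le_trans _ (ltW ue))// (le_trans (opnormB_le _ _))//.
  rewrite mulr_natl mulr2n lerD// (le_trans (opnormM_le _ _))//.
    by rewrite mulrC ler_wpM2r ?opnorm_ge0// ltW.
  by rewrite ler_wpM2r ?opnorm_ge0// ltW.
Qed.
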